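(* Let $\mu\in\mathbb R$, $\sigma^2>0$, let $X_1,X_2,\dots$ be i.i.d. $\mathcal N(\mu,\sigma^2)$, fix $T\in(0,\infty)$, $M\in\mathbb N$ and $\beta>0$, and let $w(t)=\exp(-\beta t^2)$. With $\Delta_m^{(n)}$ and $H_m^{(n)}$ as in the context, for each fixed $m\in\{1,\dots,M\}$, $$\Delta_m^{(n)}=\frac1n\int_{-T}^T w(t)\psi_0(t)^2\big|H_m^{(n)}(t)\big|^2\,dt+o_{\mathbb P}(n^{-1}),$$ hence $\Delta_m^{(n)}=O_{\mathbb P}(n^{-1})$. Moreover, for every $p\ge1$, $\sup_{n\in\mathbb N}\mathbb E\big[(n\Delta_m^{(n)})^p\big]<\infty$; in particular the family $\{(n\Delta_m^{(n)})^p:n\in\mathbb N\}$ is uniformly integrable.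
   Context: For a sample $X_1,\dots,X_n$: $\bar X=\frac1n\sum_k X_k$, $S_X^2=\frac1n\sum_k(X_k-\bar X)^2$, $\widehat\psi_X(t)=\frac1n\sum_k e^{itX_k}$, $\widehat\psi_X^*(t)=\exp(-it\bar X/S_X)\,\widehat\psi_X(t/S_X)$, and $\psi_0(t)=e^{-t^2/2}$. $U_n(t)=\sqrt n(\widehat\psi_X^*(t)-\psi_0(t))$ on $[-T,T]$. For $m\in\mathbb N$: $S_m^{(n)}(t)=(\widehat\psi_X^*(t/\sqrt m))^m$, $D_m^{(n)}=S_{m+1}^{(n)}-S_m^{(n)}$, and the self-similarity discrepancy measure is $\Delta_m^{(n)}=\int_{-T}^T w(t)|D_m^{(n)}(t)|^2\,dt$. Also $$H_m^{(n)}(t)=(m+1)\frac{U_n(t/\sqrt{m+1})}{\psi_0(t/\sqrt{m+1})}-m\frac{U_n(t/\sqrt m)}{\psi_0(t/\sqrt m)}.$$ *)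

(* Defs.v *)
From HB Require Import structures.
From mathcomp Require Import all_boot all_order all_algebra.
From mathcomp Require Import all_classical all_reals all_analysis.
From mathcomp Require Import complex.

Set Implicit Arguments.
Unset Strict Implicit.
Unset Printing Implicit Defensive.

Import Order.TTheory GRing.Theory Num.Theory.
Import numFieldNormedType.Exports.

Local Open Scope classical_set_scope.
Local Open Scope ring_scope.
Local Open Scope complex_scope.

Section Defs.
Context (R : realType).

Definition cexpi (theta : R) : R[i] := (cos theta +i* sin theta)%C.

Definition sqmod (z : R[i]) : R := (Normc.normc z) ^+ 2.

(* standard normal characteristic function psi_0(t) = e^{-t^2/2} *)
Definition psi0 (t : R) : R := expR (- (t ^+ 2) / 2).

Context {T : Type}.
Variable X : nat -> T -> R.
(* the sample of size n is X 0, ..., X (n-1) (i.e. X_1, ..., X_n) *)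

Definition smean (n : nat) (w : T) : R := (\sum_(k < n) X k w) / n%:R.

Definition ssd (n : nat) (w : T) : R :=
  Num.sqrt ((\sum_(k < n) (X k w - smean n w) ^+ 2) / n%:R).

Definition ecf (n : nat) (w : T) (t : R) : R[i] :=
  (\sum_(k < n) cexpi (t * X k w)) / n%:R.

Definition ecf_std (n : nat) (w : T) (t : R) : R[i] :=
  cexpi (- (t * smean n w / ssd n w)) * ecf n w (t / ssd n w).

Definition Un (n : nat) (w : T) (t : R) : R[i] :=
  (Num.sqrt n%:R)%:C * (ecf_std n w t - (psi0 t)%:C).

Definition Sm (n m : nat) (w : T) (t : R) : R[i] :=
  ecf_std n w (t / Num.sqrt m%:R) ^+ m.

Definition Dm (n m : nat) (w : T) (t : R) : R[i] :=
  Sm n m.+1 w t - Sm n m w t.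

Definition Delta (wt : R -> R) (TT : R) (n m : nat) (w : T) : R :=
  Rintegral lebesgue_measure `[- TT, TT] (fun t => wt t * sqmod (Dm n m w t)).

Definition Hm (n m : nat) (w : T) (t : R) : R[i] :=
  m.+1%:R * (Un n w (t / Num.sqrt m.+1%:R) / (psi0 (t / Num.sqrt m.+1%:R))%:C)
  - m%:R * (Un n w (t / Num.sqrt m%:R) / (psi0 (t / Num.sqrt m%:R))%:C).

End Defs.

Section Prob.
Local Open Scope ereal_scope.
Context (d : measure_display) (T : measurableType d) (R : realType).

Definition mutually_independent (P : probability T R) (X : nat -> T -> R) :=
  forall (J : seq nat) (A : nat -> set R), uniq J ->
    (forall j, measurable (A j)) ->
    P (\big[setI/setT]_(j <- J) (X j @^-1` A j))
    = \prod_(j <- J) P (X j @^-1` A j).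

Definition unif_integrable (P : probability T R) (Y : nat -> T -> R) :=
  forall eps : R, (0 < eps)%R -> exists K : R, forall n, (0 < n)%N ->
    'E_P[fun w => (if K < `|Y n w| then `|Y n w| else 0)%R] <= eps%:E.
End Prob.

(* Main.v *)
Require Import Defs.
From HB Require Import structures.
From mathcomp Require Import all_boot all_order all_algebra.
From mathcomp Require Import all_classical all_reals all_analysis.
From mathcomp Require Import complex measurable_realfun ring lra.
Import Order.TTheory GRing.Theory Num.Theory.
Import numFieldNormedType.Exports.
Local Open Scope classical_set_scope.
Local Open Scope ring_scope.

(** Write [z_k = (X_k - mu) / sigma] and [Y_k = (X_k - mean) / S] for the
    standardized sample, so that the statistic is the empirical transform of the
    [Y_k].  As [z_k = zbar + (S / sigma) Y_k] with [sum Y_k ^ 2 <= n], replacing [Y_k]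
    by [z_k] costs at most [|t| (|1 - S / sigma| + |zbar|)]: no negative moment of [S]
    is ever needed.  Hence [|U_n(t)|] is dominated by normalized sums of centered
    functions of the Gaussian scores, which have moments of all orders, uniformly
    in [n] and [t], by an exponential-moment bound.  Taylor expansion of
    [z ^ j] around [psi0 (t / sqrt j)], whose [j]-th power is [psi0 t] for every [j],
    shows that [sqrt n D] and [psi0 H] are both bounded by a combination [g] of
    [|U_n(t / sqrt m.+1)|] and [|U_n(t / sqrt m)|] and differ by at most [g ^ 2 / sqrt n].
    Tonelli, Jensen and Markov conclude. *)

Set Implicit Arguments.
Unset Strict Implicit.
Unset Printing Implicit Defensive.

(** * Independence *)

(** No supremum over [t] and no central limit theorem is used: the discrepancy is an integral in
    [t], so moment bounds at each fixed [t] suffice once their constant serves the whole window. The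
    scale correction brings in the centered function [z ^ 2 - 1]. Quadratic growth must therefore be
    allowed, and exponential moments are available only for small multiples. This makes
    [exp (z ^ 2 / 4)], of mean [sqrt 2] under the normal law, the common dominating function. After
    scaling by [1 / sqrt n], centering removes the linear term, each factor has exponential moment
    [1 + O(1 / n)], and the product of [n] of them stays bounded. Independence is assumed for events
    whereas this product involves expectations of nonnegative functions, which is why the
    development opens with weighted image measures. Mean, variance and characteristic function of
    the normal law all come from Stein's identity. Squaring turns the gap [g ^ 2 / sqrt n] into
    [2 * g ^ 3 / sqrt n], so the expansion consumes third moments of [g], while the [q]-th moment of
    [n * Delta] consumes those of order [2 * q]. *)

Section density.
Local Open Scope ereal_scope.
Context d d' (T : measurableType d) (T' : measurableType d') (R : realType).
Variables (mu : {measure set T -> \bar R}) (nu : {measure set T' -> \bar R}).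
Variables (phi : T -> T') (f : T -> R) (c : R).
Hypotheses (mphi : measurable_fun setT phi) (mf : measurable_fun setT f).
Hypotheses (f0 : forall x, (0 <= f x)%R) (c0 : (0 <= c)%R).
Hypothesis densE : forall A, measurable A ->
  \int[mu]_(x in phi @^-1` A) (f x)%:E = c%:E * nu A.

Import HBNNSimple.

Let ge0_integral_density_nnsfun (h : {nnsfun T' >-> R}) :
  \int[mu]_x ((h (phi x))%:E * (f x)%:E) = c%:E * \int[nu]_y (h y)%:E.
Proof.
have mphiS (A : set T') : measurable A -> measurable (phi @^-1` A).
  by move=> mA; rewrite -[X in measurable X]setTI; exact: mphi.
have h0 r : measurable (h @^-1` [set r]) by exact: measurable_sfunP.
have hphi r : measurable_fun setT (fun x => \1_(h @^-1` [set r]) (phi x) : R).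
  by apply: measurableT_comp => //; exact: measurable_indic.
rewrite -ge0_integralZl//; last 2 first.
- exact/measurable_EFinP.
- by move=> y _; rewrite lee_fin.
transitivity (\int[mu]_x (\sum_(r \in range h)
    ((r * \1_(h @^-1` [set r]) (phi x) * f x)%:E))).
  apply: eq_integral => x _.
  rewrite fsumEFin//= -EFinM; congr EFin.
  rewrite {1}fimfunE mulrC mulr_fsumr//.
  by apply: eq_fsbigr => r _; rewrite mulrC.
rewrite ge0_integral_fsum//; last 2 first.
- move=> r; apply/measurable_EFinP; apply: measurable_funM => //.
  by apply: measurable_funM => //.
- move=> r x _; rewrite lee_fin mulr_ge0//.
  by have := nnfun_muleindic_ge0 h r (phi x); rewrite -EFinM lee_fin.
transitivity (\int[nu]_y (\sum_(r \in range h)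
    ((c * (r * \1_(h @^-1` [set r]) y))%:E))); last first.
  apply: eq_integral => x _.
  by rewrite fsumEFin//= -EFinM; congr EFin; rewrite [in RHS]fimfunE mulr_fsumr.
rewrite ge0_integral_fsum//; last 2 first.
- move=> r; apply/measurable_EFinP; apply: measurable_funM => //.
  by apply: measurable_funM => //; exact: measurable_indic.
- move=> r x _; rewrite lee_fin mulr_ge0//.
  by have := nnfun_muleindic_ge0 h r x; rewrite -EFinM lee_fin.
apply: eq_fsbigr => r /[!inE] -[y _ hyr].
have r0 : (0 <= r)%R by rewrite -hyr.
under eq_integral do rewrite -mulrA EFinM.
rewrite ge0_integralZl//; last 2 first.
- by apply/measurable_EFinP; apply: measurable_funM.
- by move=> x _; rewrite lee_fin mulr_ge0.
under [RHS]eq_integral do rewrite mulrCA EFinM.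
rewrite ge0_integralZl//; last 2 first.
- by apply/measurable_EFinP; apply: measurable_funM => //; exact: measurable_indic.
- by move=> x _; rewrite lee_fin mulr_ge0.
congr (_ * _).
under [RHS]eq_integral do rewrite EFinM.
rewrite ge0_integralZl//; last first.
  by apply/measurable_EFinP; exact: measurable_indic.
rewrite integral_indic// setIT -densE// [RHS]integral_mkcond.
apply: eq_integral => x _; rewrite patchE indicE.
have -> : (phi x \in h @^-1` [set r]) = (x \in phi @^-1` (h @^-1` [set r])) by [].
by case: ifPn => _; rewrite ?(mul1r,mul0r).
Qed.

(** By [densE] the image under [phi] of the measure with density [f] is [c * nu]; simple functions
    and monotone convergence extend this from sets to integrands. It serves for the product of the
    remaining factors in an independence argument, for the normal density, and for the law of one
    observation with [f = 1]. *)
Lemma ge0_integral_density (g : T' -> \bar R) :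
  measurable_fun setT g -> (forall y, 0 <= g y) ->
  \int[mu]_x (g (phi x) * (f x)%:E) = c%:E * \int[nu]_y g y.
Proof.
move=> mg g0; pose g_ := nnsfun_approx measurableT mg.
transitivity (limn (fun n => \int[mu]_x ((g_ n (phi x))%:E * (f x)%:E))).
  rewrite -monotone_convergence//=.
  - apply: eq_integral => x _; apply/esym/cvg_lim => //=.
    apply: cvgeZr => //.
    by apply: (@cvg_nnsfun_approx _ _ _ _ measurableT _ mg (fun x _ => g0 x)).
  - move=> n; apply/measurable_EFinP; apply: measurable_funM => //.
    by apply: measurableT_comp.
  - by move=> n x _; rewrite lee_fin mulr_ge0.
  - move=> x _ a b ab; rewrite lee_fin ler_wpM2r//.
    exact/lefP/nd_nnsfun_approx.
rewrite (_ : \int[nu]_x _ = limn (fun n => \int[nu]_x (g_ n x)%:E)); last first.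
  rewrite -monotone_convergence//=.
  - apply: eq_integral => x _; apply/esym/cvg_lim => //=.
    by apply: (@cvg_nnsfun_approx _ _ _ _ measurableT _ mg (fun x _ => g0 x)).
  - by move=> n; exact/measurable_EFinP.
  - by move=> n x _; rewrite lee_fin.
  - by move=> x _ a b ab; rewrite lee_fin; exact/lefP/nd_nnsfun_approx.
rewrite -limeMl//.
  by congr (limn _); apply/funext => n /=; rewrite ge0_integral_density_nnsfun.
apply/ereal_nondecreasing_is_cvgn => a b ab; apply: ge0_le_integral => //.
- by move=> x _; rewrite lee_fin.
- exact/measurable_EFinP.
- exact/measurable_EFinP.
- by move=> x _; rewrite lee_fin; exact/lefP/nd_nnsfun_approx.
Qed.

End density.

Section independence.
Local Open Scope ereal_scope.
Context d (T : measurableType d) (R : realType) (P : probability T R).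
Variable X : nat -> {RV P >-> R}.
Hypothesis indX : mutually_independent P (fun k => (X k : T -> R)).

Lemma mutually_independent_integral_prod (J : seq nat) (f : nat -> R -> R)
    (e : nat -> R) :
  uniq J -> (forall j, measurable_fun setT (f j)) ->
  (forall j x, (0 <= f j x)%R) ->
  (forall j, \int[P]_w (f j (X j w))%:E = (e j)%:E) ->
  \int[P]_w (\prod_(j <- J) f j (X j w))%:E = (\prod_(j <- J) e j)%:E.
Proof.
move=> uJ mf f0 fe.
have e0 j : (0 <= e j)%R.
  by rewrite -lee_fin -fe integral_ge0// => x _; rewrite lee_fin.
have mX j : measurable_fun setT (X j) by [].
(* The [f j] replace indicator functions one index at a time. *)
suff H : forall (J1 J2 : seq nat) (A : nat -> set R), uniq (J1 ++ J2) ->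
    (forall j, measurable (A j)) ->
    \int[P]_w (\prod_(j <- J1) f j (X j w) *
               \prod_(j <- J2) \1_(X j @^-1` A j) w)%:E =
    (\prod_(j <- J1) e j)%:E * \prod_(j <- J2) P (X j @^-1` A j).
  have /= := H J [::] (fun=> setT).
  rewrite cats0 big_nil mule1 => <-//.
  by apply: eq_integral => w _; rewrite big_nil mulr1.
elim=> [|j J1 IH] J2 A.
  move=> /= uJ2 mA; rewrite big_nil mul1e -indX//.
  have -> : (fun w => (\prod_(j <- [::]) f j (X j w) *
      \prod_(j <- J2) \1_(X j @^-1` A j) w)%:E) =
      (fun w => (\1_(\big[setI/setT]_(j <- J2) (X j @^-1` A j)) w)%:E).
    apply/funext => w; congr EFin; rewrite big_nil mul1r.
    elim: (J2) => [|i s IHs]; first by rewrite !big_nil indicT.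
    by rewrite !big_cons IHs indicI.
  rewrite integral_indic ?setIT//.
  elim/big_ind : _ => //=; first by move=> *; exact: measurableI.
  by move=> i _; rewrite -[X in measurable X]setTI; exact: mX.
rewrite cat_cons cons_uniq mem_cat negb_or => /andP[/andP[jJ1 jJ2] uJ12] mA.
pose G w := (\prod_(j <- J1) f j (X j w) *
             \prod_(j <- J2) \1_(X j @^-1` A j) w : R)%R.
pose c := ((\prod_(j <- J1) e j) * fine (\prod_(j <- J2) P (X j @^-1` A j)))%R.
have mXA i (B : set R) : measurable B -> measurable (X i @^-1` B).
  by move=> mB; rewrite -[X in measurable X]setTI; exact: mX.
have cE : c%:E = (\prod_(j <- J1) e j)%:E * \prod_(j <- J2) P (X j @^-1` A j).
  rewrite EFinM fineK//; elim/big_ind : _ => //; first exact: fin_numM.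
  by move=> i _; rewrite fin_num_measure//; exact: mXA.
have c0 : (0 <= c)%R.
  apply: mulr_ge0; first by apply: prodr_ge0.
  by apply: fine_ge0; elim/big_ind : _ => // x y; exact: mule_ge0.
have G0 w : (0 <= G w)%R.
  by apply: mulr_ge0; apply: prodr_ge0 => // i _; rewrite indicE.
have mG : measurable_fun setT G.
  apply: measurable_funM; apply: measurable_prod => i _.
    by apply: measurableT_comp => //.
  by apply: measurable_indic; exact: mXA.
(* The law of [X j] under the weight [G] is [c] times its law under [P]. This is the induction
   hypothesis with [j] moved to the list of indicators; [A'] can differ from [A] only at [j], and
   [j] is not in [J2], so the other factors are unchanged. *)
have densG (B : set R) : measurable B ->
    \int[P]_(w in X j @^-1` B) (G w)%:E = c%:E * pushforward P (X j) B.
  move=> mB.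
  pose A' i := if i == j then B else A i.
  have J2A' (F : set R -> nat -> R) : (\prod_(i <- J2) F (A' i) i = \prod_(i <- J2) F (A i) i)%R.
    apply: eq_big_seq => i iJ2; rewrite /A'; case: eqP => // ij.
    by move: jJ2; rewrite -ij iJ2.
  have J2A'e (F : set R -> nat -> \bar R) : \prod_(i <- J2) F (A' i) i = \prod_(i <- J2) F (A i) i.
    apply: eq_big_seq => i iJ2; rewrite /A'; case: eqP => // ij.
    by move: jJ2; rewrite -ij iJ2.
  have := IH (j :: J2) A'.
  have -> : uniq (J1 ++ j :: J2).
    by move: uJ12; rewrite !cat_uniq /= (negbTE jJ1) jJ2 => /and3P[-> -> ->].
  move=> /(_ isT) H.
  rewrite cE -muleA [X in _ * X]muleC.
  have -> : pushforward P (X j) B = P (X j @^-1` (A' j)) by rewrite /A' eqxx.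
  rewrite -(J2A'e (fun B i => P (X i @^-1` B))).
  have := H _; rewrite big_cons => <-; last first.
    by move=> i; rewrite /A'; case: ifP.
  rewrite integral_mkcond; apply: eq_integral => w _.
  rewrite patchE big_cons /G (J2A' (fun B i => \1_(X i @^-1` B) w)).
  rewrite /A' eqxx indicE; case: ifPn => _; rewrite ?mul1r//.
  by rewrite mul0r mulr0.
have Ew : (fun w => (\prod_(j <- (j :: J1)) f j (X j w) *
    \prod_(j <- J2) \1_(X j @^-1` A j) w)%:E) =
    (fun w => (f j (X j w))%:E * (G w)%:E).
  by apply/funext => w; rewrite big_cons -EFinM /G mulrA.
rewrite Ew.
rewrite (@ge0_integral_density _ _ _ _ _ P (pushforward P (X j)) (X j) G c
  _ _ _ _ densG (fun x => (f j x)%:E))//; last 2 first.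
- exact/measurable_EFinP.
- by move=> y; rewrite lee_fin.
rewrite ge0_integral_pushforward//; last 2 first.
- exact/measurable_EFinP.
- by move=> y _; rewrite lee_fin.
rewrite preimage_setT fe cE big_cons EFinM.
by rewrite muleC muleA.
Qed.

End independence.

(** * Gaussian expectations *)

Section normal_expectation.
Context (R : realType) (mu sigma : R).
Hypothesis sigma0 : 0 < sigma.
Notation gamma := (normal_prob mu sigma).
Notation leb := (@lebesgue_measure R).

Definition zscore (x : R) : R := (x - mu) / sigma.
Local Notation zeta := zscore.

Lemma continuous_zscore : continuous zeta.
Proof.
move=> x; apply: cvgM; last exact: cvg_cst.
by apply: cvgB => //; exact: cvg_cst.
Qed.

Lemma measurable_zscore : measurable_fun setT zeta.
Proof. exact: continuous_measurable_fun continuous_zscore. Qed.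

Lemma ge0_integral_normal_prob (f : R -> \bar R) :
  measurable_fun setT f -> (forall x, 0 <= f x)%E ->
  (\int[gamma]_x f x = \int[leb]_x (f x * (normal_pdf mu sigma x)%:E))%E.
Proof.
move=> mf f0; rewrite -[LHS]mul1e; apply/esym.
apply: (@ge0_integral_density _ _ _ _ R leb gamma id (normal_pdf mu sigma) 1) => //.
- exact: measurable_normal_pdf.
- by move=> x; exact: normal_pdf_ge0.
- by move=> A mA; rewrite mul1e.
Qed.

Lemma normal_pdf_peakE (m s x : R) : s != 0 ->
  normal_pdf m s x = normal_peak s * normal_fun m s x.
Proof. by move=> s0; rewrite normal_pdfE. Qed.

Lemma normal_peak_sqrt2 :
  normal_peak (sigma * Num.sqrt 2) = normal_peak sigma / Num.sqrt 2.
Proof.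
rewrite /normal_peak -invfM exprMn (sqr_sqrtr (ler0n R 2)).
have -> : sigma ^+ 2 * 2 * pi *+ 2 = (sigma ^+ 2 * pi *+ 2) * 2 by ring.
by rewrite sqrtrM// mulrn_wge0// mulr_ge0 ?sqr_ge0 ?pi_ge0.
Qed.

(** The factor [exp (zeta ^ 2 / 4)] halves the Gaussian exponent, which gives the normal density of
    standard deviation [sigma * sqrt 2]; the ratio of the two peaks is the value [sqrt 2]. *)
Lemma integral_normal_prob_expR :
  (\int[gamma]_x (expR (zeta x ^+ 2 / 4))%:E = (Num.sqrt 2)%:E)%E.
Proof.
have s2 : 0 < Num.sqrt 2 :> R by rewrite sqrtr_gt0.
have ss0 : sigma * Num.sqrt 2 != 0 by rewrite mulf_neq0// gt_eqF.
rewrite ge0_integral_normal_prob//; last first.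
  apply/measurable_EFinP; apply: measurableT_comp => //.
  by apply: measurable_funM => //; apply: measurable_funX; exact: measurable_zscore.
transitivity (\int[leb]_x ((Num.sqrt 2)%:E *
    (normal_pdf mu (sigma * Num.sqrt 2) x)%:E))%E.
  apply: eq_integral => x _; rewrite -!EFinM; congr EFin.
  rewrite (@normal_pdf_peakE mu sigma x) ?gt_eqF//.
  rewrite (@normal_pdf_peakE mu (sigma * Num.sqrt 2) x)// normal_peak_sqrt2.
  have -> : normal_fun mu (sigma * Num.sqrt 2) x =
      expR (zeta x ^+ 2 / 4) * normal_fun mu sigma x.
    rewrite /normal_fun -expRD; congr expR; rewrite exprMn sqr_sqrtr// /zscore.
    by field; rewrite gt_eqF.
  by field; rewrite gt_eqF.
rewrite ge0_integralZl//.
- by rewrite integral_normal_pdf mule1.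
- by apply/measurable_EFinP; exact: measurable_normal_pdf.
- by move=> x _; rewrite lee_fin normal_pdf_ge0.
Qed.

Lemma integrable_normal_prob (f : R -> R) (C : R) :
  measurable_fun setT f -> (forall x, `|f x| <= C * expR (zeta x ^+ 2 / 4)) ->
  gamma.-integrable setT (EFin \o f).
Proof.
move=> mf fC; apply: (@le_integrable _ _ _ gamma _ measurableT _
    (fun x => C%:E * (expR (zeta x ^+ 2 / 4))%:E)%E).
- exact/measurable_EFinP.
- by move=> x _; rewrite -EFinM /= lee_fin (le_trans (fC x))// ler_norm.
- apply: integrableZl => //; apply/integrableP; split.
    apply/measurable_EFinP; apply: measurableT_comp => //.
    by apply: measurable_funM => //; apply: measurable_funX; exact: measurable_zscore.
  under eq_integral do rewrite abse_EFin ger0_norm ?expR_ge0//.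
  by rewrite integral_normal_prob_expR ltry.
Qed.

(** Positive and negative parts commute with multiplication by the nonnegative density, so the
    signed case follows from the nonnegative one. The Lebesgue integrability in the first conjunct
    provides the dominating function for the limit of windows in Stein's identity. *)
Lemma integral_normal_prob (f : R -> R) (C : R) :
  measurable_fun setT f -> (forall x, `|f x| <= C * expR (zeta x ^+ 2 / 4)) ->
  leb.-integrable setT (fun x => (f x * normal_pdf mu sigma x)%:E) /\
  (\int[gamma]_x (f x)%:E = \int[leb]_x (f x * normal_pdf mu sigma x)%:E)%E.
Proof.
move=> mf fC.
have mpdf : measurable_fun setT (normal_pdf mu sigma) by exact: measurable_normal_pdf.
have := @integrable_normal_prob _ _ mf fC; rewrite /comp => /= ifg.
have ifl : leb.-integrable setT (fun x => (f x * normal_pdf mu sigma x)%:E).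
  apply/integrableP; split.
    by apply/measurable_EFinP; apply: measurable_funM.
  have /integrableP[_] := ifg.
  rewrite ge0_integral_normal_prob//; last first.
    by apply: measurableT_comp => //; exact/measurable_EFinP.
  apply: le_lt_trans; rewrite le_eqVlt; apply/orP; left; apply/eqP.
  apply: eq_integral => x _.
  by rewrite /= normrM (ger0_norm (normal_pdf_ge0 _ _ _)) EFinM.
split=> //; rewrite integralE [RHS]integralE.
rewrite ge0_integral_normal_prob//; last first.
  by apply: measurable_funepos; exact/measurable_EFinP.
rewrite ge0_integral_normal_prob//; last first.
  by apply: measurable_funeneg; exact/measurable_EFinP.
congr (_ - _)%E; apply: eq_integral => x _.
  rewrite !funeposE -EFin_max -EFinM -[RHS]EFin_max; congr EFin.
  by rewrite maxr_pMl ?normal_pdf_ge0// mul0r.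
rewrite !funenegE -!EFinN -EFin_max -EFinM -[RHS]EFin_max; congr EFin.
by rewrite maxr_pMl ?normal_pdf_ge0// mul0r mulNr.
Qed.

End normal_expectation.

(** * Stein's identity for the normal law *)

Section normal_moments.
Context (R : realType) (mu sigma : R).
Hypothesis sigma0 : 0 < sigma.
Notation gamma := (normal_prob mu sigma).
Notation leb := (@lebesgue_measure R).
Local Notation zeta := (zscore mu sigma).

Let sigmaN0 : sigma != 0. Proof. by rewrite gt_eqF. Qed.

Lemma expR_sqr_quarter_ge (z : R) : 1 + z ^+ 2 / 4 <= expR (z ^+ 2 / 4).
Proof. exact: expR_ge1Dx. Qed.

Lemma is_derive_zscore (x : R) : is_derive x 1 zeta sigma^-1.
Proof.
have -> : zeta = (fun y => (y - mu) * sigma^-1) by [].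
apply: is_derive_eq.
by rewrite subr0 scaler0 add0r [LHS]mulr1.
Qed.

Lemma is_derive_normal_pdf (x : R) :
  is_derive x 1 (normal_pdf mu sigma) (- (zeta x / sigma) * normal_pdf mu sigma x).
Proof.
rewrite normal_pdfE//.
have -> : (fun x => normal_peak sigma * normal_fun mu sigma x) =
    (fun x => normal_peak sigma * expR (- (zeta x * zeta x) / 2)).
  apply/funext => y; congr (_ * expR _); rewrite /zscore; by field.
have D := is_derive_zscore x.
apply: is_derive_eq.
rewrite /= /GRing.scale/=.
have -> : normal_fun mu sigma x = expR (- (zeta x * zeta x) / 2).
  congr expR; rewrite /zscore; by field.
by field.
Qed.

(* The integrand is [(sigma g(zeta) pdf)' / pdf]. *)
Lemma normal_stein (g g' : R -> R) (C : R) :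
  (forall z : R, is_derive z 1 g (g' z)) -> continuous g' ->
  (forall z, `|g z| <= C * (1 + `|z|)) -> (forall z, `|g' z| <= C) ->
  (\int[gamma]_x (g' (zeta x) - zeta x * g (zeta x))%:E = 0)%E.
Proof.
move=> dg cg' gC g'C.
have C0 : 0 <= C by exact: le_trans (g'C 0).
pose h x := g' (zeta x) - zeta x * g (zeta x).
have cg : continuous g.
  by move=> z; apply: differentiable_continuous; apply/derivable1_diffP; case: (dg z).
have cz := @continuous_zscore R mu sigma.
have ch : continuous h.
  move=> x; apply: cvgB; first by apply: continuous_comp; [exact: cz|exact: cg'].
  by apply: cvgM; [exact: cz|apply: continuous_comp; [exact: cz|exact: cg]].
have mh : measurable_fun setT h by exact: continuous_measurable_fun.
have hC x : `|h x| <= (C * 6) * expR (zeta x ^+ 2 / 4).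
  have W1 := expR_sqr_quarter_ge (zeta x).
  set z := zeta x in W1 *; set W := expR _ in W1 *.
  apply: (le_trans (ler_normB _ _)); rewrite normrM.
  have gz := gC z; have g'z := g'C z; rewrite -/z.
  have zg : `|z| * `|g z| <= `|z| * (C * (1 + `|z|)) by rewrite ler_wpM2l.
  have zz : `|z| * `|z| = z ^+ 2 by rewrite -expr2 real_normK ?num_real.
  have zW : `|z| <= W.
    have : 0 <= (1 - `|z| / 2) ^+ 2 by exact: sqr_ge0.
    nra.
  have : C * (1 + `|z| + z ^+ 2) <= C * 6 * W.
    rewrite -mulrA ler_wpM2l//; have := sqr_ge0 z; nra.
  nra.
have [ifl ->] := integral_normal_prob sigma0 mh hC.
(* The windows are symmetric in the score: [zeta] takes the values [- n.+1] and [n.+1] at the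
   endpoints. The shift to [n.+1] keeps them nondegenerate and matches [harmonic n]. *)
pose a n : R := mu - n.+1%:R * sigma.
pose b n : R := mu + n.+1%:R * sigma.
pose H x := h x * normal_pdf mu sigma x.
pose G x := sigma * (g (zeta x) * normal_pdf mu sigma x).
have dG (x : R) : is_derive x 1 G (H x).
  have D1 := is_derive_zscore x.
  have D2 := is_derive_normal_pdf x.
  have D3 : is_derive x 1 (g \o zeta) (sigma^-1 * g' (zeta x)).
    by have := dg (zeta x) => D0; rewrite mulrC; apply: is_derive1_comp.
  have -> : G = (fun x => sigma * ((g \o zeta) x * normal_pdf mu sigma x)) by [].
  apply: is_derive_eq; rewrite /H /h /GRing.scale/=.
  by field.
have cG : continuous G.
  by move=> z; apply: differentiable_continuous; apply/derivable1_diffP; case: (dG z).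
have cpdf := @continuous_normal_pdf R mu sigma sigmaN0.
have cH : continuous H by move=> x; apply: cvgM; [exact: ch|exact: cpdf].
have ab n : a n < b n.
  by rewrite /a /b -subr_gt0 opprD opprK addrACA subrr add0r addr_gt0// mulr_gt0.
have FTC n : (\int[leb]_(x in `[a n, b n]) (H x)%:E = (G (b n))%:E - (G (a n))%:E)%E.
  apply: continuous_FTC2 => //.
  - exact: continuous_subspaceT.
  - split.
    + by move=> x _; case: (dG x).
    + exact/cvg_at_right_filter/cG.
    + exact/cvg_at_left_filter/cG.
  - by move=> x _; rewrite derive1E; apply: derive_val.
have zb n : zeta (b n) = n.+1%:R by rewrite /zscore /b addrAC subrr add0r mulfK.
have za n : zeta (a n) = - n.+1%:R.
  by rewrite /zscore /a addrAC subrr add0r mulNr mulfK.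
have lim0 : (\int[leb]_(x in `[a n, b n]) (H x)%:E @[n --> \oo] --> 0)%E.
  under eq_fun do rewrite FTC -EFinB.
  apply: cvg_EFin; first exact: nearW.
  rewrite /comp /=.
  pose K := sigma * C * normal_peak sigma * 8.
  have K0 : 0 <= K by rewrite !mulr_ge0// ?normal_peak_ge0// ltW.
  have hs : K * harmonic n @[n --> \oo] --> (0 : R).
    by rewrite -(mulr0 K); apply: cvgMr; exact: cvg_harmonic.
  (* With [k = n.+1] and [E = exp (k ^ 2 / 2)], the boundary terms are at most [sigma * normal_peak
     sigma * 2 * C * (1 + k) / E]. The crude bound [E >= 1 + k ^ 2 / 2] already gives
     [2 * (1 + k) <= 8 * E / k], the origin of the [8] in [K]. *)
  have hbnd (n : nat) : `|G (b n) - G (a n)| <= K * harmonic n.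
    have k0 : 0 < n.+1%:R :> R by [].
    rewrite /G zb za normal_pdfE//.
    have -> : normal_fun mu sigma (b n) = expR (- (n.+1%:R ^+ 2 / 2)).
      by congr expR; rewrite /b; field.
    have -> : normal_fun mu sigma (a n) = expR (- (n.+1%:R ^+ 2 / 2)).
      by congr expR; rewrite /a; field.
    rewrite expRN /harmonic; set k : R := n.+1%:R in k0 *.
    have E1 : 1 + k ^+ 2 / 2 <= expR (k ^+ 2 / 2) by exact: expR_ge1Dx.
    set E := expR _ in E1 *.
    have E0 : 0 < E by rewrite expR_gt0.
    have -> : sigma * (g k * (normal_peak sigma * E^-1)) -
      sigma * (g (- k) * (normal_peak sigma * E^-1)) =
      sigma * normal_peak sigma * ((g k - g (- k)) / E) by ring.
    rewrite !normrM (gtr0_norm sigma0) (ger0_norm (normal_peak_ge0 _)).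
    have -> : K / k = sigma * normal_peak sigma * (C * 8 * k^-1).
      by rewrite /K; field; rewrite gt_eqF.
    rewrite ler_wpM2l ?mulr_ge0 ?normal_peak_ge0 ?(ltW sigma0)//.
    rewrite normfV (gtr0_norm E0) ler_pdivrMr//.
    have g1 := gC k; have g2 := gC (- k); rewrite normrN (gtr0_norm k0) in g1 g2.
    apply: (le_trans (ler_normB _ _)).
    have : 2 * (1 + k) <= 8 * k^-1 * E.
      rewrite mulrAC ler_pdivlMr//; nra.
    move=> kE; have -> : C * 8 * k^-1 * E = C * (8 * k^-1 * E) by ring.
    by apply: le_trans (ler_wpM2l C0 kE); lra.
  apply: norm_cvg0; apply: (@squeeze_cvgr _ _ _ _ (cst 0) _ _ _ _ _ hs) => //.
    by apply: nearW => n; rewrite /= normr_ge0 hbnd.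
  exact: cvg_cst.
have mH : measurable_fun setT H by exact: continuous_measurable_fun.
have mab n : measurable (`[a n, b n]%classic : set R) by exact: measurable_itv.
have [||||| _ _ lim1] := @dominated_convergence _ _ R leb setT measurableT
  (fun n x => ((H \_ `[a n, b n]) x)%:E) (fun x => (H x)%:E)
  (fun x => `|(H x)%:E|)%E.
- move=> n; apply/measurable_EFinP.
  by apply/(measurable_restrictT _ _).1 => //; exact: measurable_funTS.
- exact/measurable_EFinP.
- apply: aeW => x _; apply: cvg_near_cst.
  near=> n; congr EFin; rewrite patchE ifT// inE /= in_itv /= /a /b.
  have nx : `|x - mu| / sigma <= n.+1%:R.
    by apply: (@le_trans _ _ n%:R); [near: n; exact: nbhs_infty_ger|rewrite ler_nat].
  move: nx; rewrite ler_pdivrMr// ler_norml => /andP[x1 x2].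
  by apply/andP; split; lra.
- exact: integrable_abse.
- apply: aeW => x n _; rewrite patchE; case: ifP => // _.
  by rewrite abse0 abse_ge0.
move: lim1; rewrite [X in X @ _ --> _](_ : _ =
    (fun n => \int[leb]_(x in `[a n, b n]) (H x)%:E)%E); last first.
  apply/funext => n; rewrite [RHS]integral_mkcond.
  by apply: eq_integral => x _; rewrite restrict_EFin.
move=> lim1; exact: (cvg_unique _ lim1 lim0).
Unshelve. all: by end_near. Qed.

End normal_moments.

(** * Centered moments and characteristic function of the normal law *)

Section normal_characteristic.
Context (R : realType) (mu sigma : R).
Hypothesis sigma0 : 0 < sigma.
Notation gamma := (normal_prob mu sigma).
Local Notation zeta := (zscore mu sigma).

Lemma normal_mean0 : (\int[gamma]_x (zeta x)%:E = 0)%E.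
Proof.
have := @normal_stein _ mu sigma sigma0 (cst (-1)) (cst 0) 1.
rewrite (_ : (fun x => _) = (fun x => (zeta x)%:E)); last first.
  by apply/funext => x; rewrite /= mulrN1 opprK add0r.
apply.
- by move=> z; exact: cvg_cst.
- by move=> z; rewrite normrN1 mul1r lerDl.
- by move=> z; rewrite normr0.
Qed.

Lemma normal_variance1 : (\int[gamma]_x (zeta x ^+ 2 - 1)%:E = 0)%E.
Proof.
have := @normal_stein _ mu sigma sigma0 (fun z => - z) (cst (-1)) 1.
rewrite (_ : (fun x => _) = (fun x => (zeta x ^+ 2 - 1)%:E)); last first.
  by apply/funext => x; rewrite /= mulrN opprK addrC expr2.
apply.
- by move=> z; exact: cvg_cst.
- by move=> z; rewrite normrN mul1r lerDr.
- by move=> z; rewrite normrN1.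
Qed.

(* By Stein's identity [f t := E F(t zeta)] solves [f' = - t f], for [F] either [cos]
   or [sin]. *)
Section transform.
Variables F F1 : R -> R.
Hypothesis dF : forall z : R, is_derive z 1 F (F1 z).
Hypothesis dF1 : forall z : R, is_derive z 1 F1 (- F z).
Hypothesis F_le1 : forall z, `|F z| <= 1.
Hypothesis F1_le1 : forall z, `|F1 z| <= 1.

Let cF : continuous F.
Proof. by move=> z; apply: differentiable_continuous; apply/derivable1_diffP; case: (dF z). Qed.

Let cF1 : continuous F1.
Proof. by move=> z; apply: differentiable_continuous; apply/derivable1_diffP; case: (dF1 z). Qed.

Let E1 (z : R) : 1 <= expR (z ^+ 2 / 4).
Proof. by rewrite (le_trans _ (expR_sqr_quarter_ge z))// lerDl divr_ge0 ?sqr_ge0. Qed.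

Let Enorm (z : R) : `|z| <= expR (z ^+ 2 / 4).
Proof.
apply: le_trans (expR_sqr_quarter_ge z).
have : 0 <= (1 - `|z| / 2) ^+ 2 by exact: sqr_ge0.
have : `|z| ^+ 2 = z ^+ 2 by rewrite real_normK ?num_real.
nra.
Qed.

Let mcomp (G : R -> R) (t : R) : continuous G -> measurable_fun setT (fun x => G (t * zeta x)).
Proof.
move=> cG; apply: measurableT_comp; first exact: continuous_measurable_fun.
by apply: measurable_funM => //; exact: measurable_zscore.
Qed.

Let iF (t : R) : gamma.-integrable setT (EFin \o (fun x => F (t * zeta x))).
Proof.
apply: (@integrable_normal_prob _ mu sigma sigma0 _ 1); first exact: mcomp.
by move=> x; rewrite mul1r (le_trans (F_le1 _)).
Qed.

Let iF1 (t : R) : gamma.-integrable setT (EFin \o (fun x => zeta x * F1 (t * zeta x))).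
Proof.
apply: (@integrable_normal_prob _ mu sigma sigma0 _ 1).
  by apply: measurable_funM; [exact: measurable_zscore|exact: mcomp].
move=> x; rewrite mul1r normrM (le_trans _ (Enorm _))//.
by rewrite -[leRHS]mulr1 ler_wpM2l.
Qed.

Let gammaT : gamma [set: measurableTypeR R] = 1%E.
Proof. exact: integral_normal_pdf. Qed.

Let Rintegral_gamma_cst (c : R) : (\int[gamma]_x c = c)%R.
Proof.
rewrite Rintegral_cst// -[RHS]mulr1; congr (_ * _).
by rewrite -[RHS]/(fine 1%E); congr fine; exact: gammaT.
Qed.

Let f (t : R) : R := \int[gamma]_x F (t * zeta x).

Let dFt (t x : R) : is_derive t 1 (fun s => F (s * zeta x)) (zeta x * F1 (t * zeta x)).
Proof.
have D : is_derive t 1 (fun s : R => s * zeta x) (zeta x).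
  by apply: is_derive_eq; rewrite scaler0 add0r /GRing.scale/= mulr1.
have D0 := dF (t * zeta x); rewrite mulrC.
by apply: (@is_derive1_comp _ F (fun s : R => s * zeta x)).
Qed.

Let df (t : R) : is_derive t 1 f (- (t * f t)).
Proof.
pose fF s x := F (s * zeta x).
have d1E s x : derive1 (fF ^~ x) s = zeta x * F1 (s * zeta x).
  by rewrite derive1E; have D := dFt s x; exact: derive_val.
have Ia : (`]t - 1, t + 1[%classic : set R) t.
  by rewrite /= in_itv/=; apply/andP; split; lra.
have intf s : (`]t - 1, t + 1[%classic : set R) s -> gamma.-integrable setT (EFin \o fF s).
  by move=> _; exact: iF.
have der s x : (`]t - 1, t + 1[%classic : set R) s -> [set: R] x ->
    derivable (fF ^~ x) s 1.
  by move=> _ _; case: (dFt s x).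
have iG : gamma.-integrable setT (EFin \o (fun x => expR (zeta x ^+ 2 / 4))).
  apply: (@integrable_normal_prob _ mu sigma sigma0 _ 1); last first.
    by move=> x; rewrite mul1r ger0_norm ?expR_ge0.
  apply: measurableT_comp => //.
  by apply: measurable_funM => //; apply: measurable_funX; exact: measurable_zscore.
(* The derivative in [s] is [zeta * F1 (s * zeta)], bounded by [|zeta|] whatever [s] is, so any open
   interval around [t] would do. *)
have Gub s x : (`]t - 1, t + 1[%classic : set R) s -> [set: R] x ->
    `|derive1 (fF ^~ x) s| <= expR (zeta x ^+ 2 / 4).
  move=> _ _; rewrite d1E normrM (le_trans _ (Enorm _))//.
  by rewrite -[leRHS]mulr1 ler_wpM2l.
have G0 x : 0 <= expR (zeta x ^+ 2 / 4) by rewrite expR_ge0.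
apply: DeriveDef.
  exact: (derivable_under_integral measurableT Ia intf der G0 iG Gub).
have := differentiation_under_integral measurableT Ia intf der G0 iG Gub.
rewrite derive1E => ->.
transitivity (\int[gamma]_x (zeta x * F1 (t * zeta x))).
  by apply: eq_Rintegral => x _; exact: d1E.
(* Stein's identity for [g z = F1 (t * z)]: since [F1' = - F], its derivative is
   [- t * F (t * z)]. *)
have S : (\int[gamma]_x (- t * F (t * zeta x) - zeta x * F1 (t * zeta x))%:E = 0)%E.
  apply: (@normal_stein _ mu sigma sigma0 (fun z => F1 (t * z))
    (fun z => - t * F (t * z)) (1 + `|t|)).
  - move=> z; have D : is_derive z 1 (fun s : R => t * s) t.
      by apply: is_derive_eq; rewrite /GRing.scale/= mulr1.
    have D0 := dF1 (t * z); rewrite mulNr -mulrN mulrC.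
    by apply: (@is_derive1_comp _ F1 (fun s : R => t * s)).
  - move=> z; apply: cvgM; first exact: cvg_cst.
    apply: continuous_comp; last exact: cF.
    by apply: cvgM; [exact: cvg_cst|exact: cvg_id].
  - move=> z; apply: (le_trans (F1_le1 _)).
    have := normr_ge0 t; have := normr_ge0 z; nra.
  - move=> z; rewrite normrM normrN.
    have := F_le1 (t * z); have := normr_ge0 t; nra.
have iF' : gamma.-integrable setT (EFin \o (fun x => - t * F (t * zeta x))).
  by have := integrableZl measurableT (- t) (iF t).
have : (\int[gamma]_x (- t * F (t * zeta x) - zeta x * F1 (t * zeta x)) = 0)%R.
  by rewrite /Rintegral S.
rewrite RintegralB// RintegralZl// => /eqP; rewrite subr_eq0 => /eqP <-.
by rewrite mulNr.
Qed.

(** The integrating factor [exp (s ^ 2 / 2)] makes [k] constant, so its value can be read at [0],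
    where the integrand is the constant [F 0]. *)
Lemma normal_transform (t : R) : f t = F 0 * psi0 t.
Proof.
pose k (s : R) := f s * expR (s ^+ 2 / 2).
have dk (s : R) : is_derive s 1 k 0.
  have D := df s.
  have D2 : is_derive s 1 (fun s : R => expR (s * s / 2)) (s * expR (s * s / 2)).
    by apply: is_derive_eq; rewrite /GRing.scale/=; field.
  rewrite (_ : k = (fun s => f s * expR (s * s / 2))); last first.
    by apply/funext => u; rewrite /k expr2.
  by apply: is_derive_eq; rewrite /GRing.scale/=; ring.
have : k t = k 0 by exact: is_derive_0_is_cst.
rewrite /k expr0n/= mul0r expR0 mulr1.
have -> : f 0 = F 0.
  rewrite /f; under eq_Rintegral do rewrite mul0r.
  exact: Rintegral_gamma_cst.
move=> <-; rewrite /psi0 -mulrA -expRD mulNr subrr expR0 mulr1//.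
Qed.

Lemma normal_transform_centered (t : R) :
  (\int[gamma]_x (F (t * zeta x) - F 0 * psi0 t)%:E = 0)%E.
Proof.
have iC : gamma.-integrable setT (EFin \o (fun x : R => F 0 * psi0 t)).
  exact: finite_measure_integrable_cst.
have := normal_transform t; rewrite /f => ft.
have : (\int[gamma]_x (F (t * zeta x) - F 0 * psi0 t) = 0)%R.
  by rewrite RintegralB// ft Rintegral_gamma_cst subrr.
(* [fine] also sends infinite values to [0], so a vanishing real integral determines the extended
   one only after integrability has been shown. *)
rewrite /Rintegral => ft0; rewrite -[LHS]fineK; first by rewrite ft0.
apply: integrable_fin_num => //.
under eq_fun do rewrite EFinB.
exact: (integrableB measurableT (iF t) iC).
Qed.

End transform.

Lemma normal_cos_centered (t : R) :
  (\int[gamma]_x (cos (t * zeta x) - psi0 t)%:E = 0)%E.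
Proof.
have := @normal_transform_centered cos (fun z => - sin z).
rewrite cos0 => H; rewrite -[RHS](H _ _ _ _ t).
- by apply: eq_integral => x _; rewrite mul1r.
- by move=> z; exact: cos_max.
- by move=> z; rewrite normrN sin_max.
Qed.

Lemma normal_sin_centered (t : R) :
  (\int[gamma]_x (sin (t * zeta x))%:E = 0)%E.
Proof.
have := @normal_transform_centered sin cos.
rewrite sin0 => H; rewrite -[RHS](H _ _ _ _ t).
- by apply: eq_integral => x _; rewrite mul0r subr0.
- by move=> z; exact: sin_max.
- by move=> z; exact: cos_max.
Qed.

End normal_characteristic.

(** * Moments of normalized sums *)

(** Only [1 + x <= exp x] is needed. At [- x] it gives [exp x - 1 <= x * exp x], which multiplied by
    [x >= 0] yields the bound on that side; for [x < 0], multiplying [1 + x <= exp x] by [- x] gives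
    [exp x <= 1 + x + x ^ 2]. *)
Lemma expR_le_quadratic (R : realType) (x : R) :
  expR x <= 1 + x + x ^+ 2 * expR `|x|.
Proof.
have e1 := expR_ge1Dx (- x).
have E0 : 0 < expR x by exact: expR_gt0.
rewrite expRN in e1.
have h1 : expR x - 1 <= x * expR x.
  have : (1 - x) * expR x <= 1.
    by rewrite -ler_pdivlMr// mul1r.
  lra.
have e2 := expR_ge1Dx x.
have [x0|x0] := leP 0 x.
  rewrite ger0_norm//; have := ler_wpM2l x0 h1; rewrite expr2; nra.
rewrite ltr0_norm//.
have x0' : 0 <= - x by lra.
have := ler_wpM2l x0' e2 => h2.
have e3 : 1 <= expR (- x) by rewrite -[leLHS]expR0 ler_expR.
have : x ^+ 2 * 1 <= x ^+ 2 * expR (- x) by rewrite ler_wpM2l ?sqr_ge0.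
rewrite expr2; nra.
Qed.

(** The square of [s] is pulled out of the remainder, so that [s = 1 / sqrt n] leaves an excess of
    order [1 / n]. The [4] comes from [y ^ 2 <= 4 * exp |y|], itself from
    [|y| / 2 <= exp (|y| / 2)]. *)
Lemma expR_scaled_le (R : realType) (s y : R) : 0 <= s <= 1 ->
  expR (s * y) <= 1 + s * y + s ^+ 2 * (4 * expR (2 * `|y|)).
Proof.
move=> /andP[s0 s1]; apply: (le_trans (expR_le_quadratic _)).
rewrite lerD2l exprMn -mulrA ler_wpM2l ?sqr_ge0//.
have y0 := normr_ge0 y.
have -> : y ^+ 2 = (2 * (`|y| / 2)) ^+ 2 by rewrite mulrCA divff ?mulr1 ?real_normK ?num_real.
have h : `|y| / 2 <= expR (`|y| / 2) by apply: le_trans (expR_ge1Dx _); lra.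
have h2 : (`|y| / 2) ^+ 2 <= expR `|y|.
  have -> : expR `|y| = expR (`|y| / 2) ^+ 2 by rewrite expr2 -expRD; congr expR; lra.
  by rewrite ler_sqr ?nnegrE ?expR_ge0 ?divr_ge0.
have h3 : expR `|s * y| <= expR `|y|.
  by rewrite ler_expR normrM (ger0_norm s0) ler_piMl.
have -> : expR (2 * `|y|) = expR `|y| * expR `|y| by rewrite -expRD; congr expR; lra.
rewrite exprMn (_ : 2 ^+ 2 = 4) -1?[leLHS]mulrA; last by rewrite -natrX.
by rewrite ler_wpM2l// ler_pM// ?sqr_ge0 ?expR_ge0.
Qed.

(** For [r > 0], raise [x / r <= exp (x / r)] to the power [r]. At [r = 0] the convention
    [0 ^ 0 = 1] keeps the right side equal to [exp x]. *)
Lemma exprn_le_expR (R : realType) (x : R) (r : nat) : 0 <= x ->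
  x ^+ r <= r%:R ^+ r * expR x.
Proof.
move=> x0; case: r => [|r].
  by rewrite !expr0 mul1r -[leLHS]expR0 ler_expR.
have r0 : 0 < r.+1%:R :> R by [].
have -> : expR x = expR (x / r.+1%:R) ^+ r.+1.
  by rewrite -expRM_natl; congr expR; field.
rewrite -exprMn lerXn2r ?nnegrE ?mulr_ge0 ?expR_ge0//.
apply: (@le_trans _ _ (r.+1%:R * (x / r.+1%:R))).
  by rewrite mulrC divfK ?gt_eqF.
by rewrite ler_wpM2l ?(ltW r0)//; apply: le_trans (expR_ge1Dx _); rewrite lerDr.
Qed.

Section normalized_sums.
Local Open Scope ereal_scope.
Context d (T : measurableType d) (R : realType) (P : probability T R).
Variables (X : nat -> {RV P >-> R}) (mu sigma : R).
Hypothesis sigma0 : (0 < sigma)%R.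
Hypothesis lawX : forall k A, measurable A -> P (X k @^-1` A) = normal_prob mu sigma A.
Hypothesis indX : mutually_independent P (fun k => (X k : T -> R)).
Notation gamma := (normal_prob mu sigma).
Local Notation zeta := (zscore mu sigma).

Lemma integral_law (k : nat) (g : R -> \bar R) :
  measurable_fun setT g -> (forall x, 0 <= g x) ->
  \int[P]_w g (X k w) = \int[gamma]_x g x.
Proof.
move=> mg g0; rewrite -[RHS]mul1e.
rewrite -(@ge0_integral_density _ _ T _ R P gamma (X k) (cst 1%R) 1%R)//.
- by apply: eq_integral => w _; rewrite mule1.
- exact: (measurable_funP (X k)).
- move=> A mA; rewrite mul1e; transitivity (P (X k @^-1` A)); last exact: lawX.
  rewrite /= integral_cst ?mul1e//.
  by rewrite -[X in measurable X]setTI; exact: (measurable_funP (X k)).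
Qed.

Definition normsum (h : R -> R) (n : nat) (w : T) : R :=
  ((\sum_(k < n) h (zeta (X k w))) / Num.sqrt n%:R)%R.

Lemma measurable_normsum (h : R -> R) (n : nat) :
  measurable_fun setT h -> measurable_fun setT (normsum h n).
Proof.
move=> mh; apply: measurable_funM => //; apply: measurable_sum => k.
apply: (measurableT_comp mh); apply: measurableT_comp => //.
exact: measurable_zscore.
Qed.

(** Bounds the mean of [4 * exp (2 * |h / 8|)]: if [|h z| <= 2 + z ^ 2], the exponent is at most
    [1 / 2 + z ^ 2 / 4], and [exp (zeta ^ 2 / 4)] has mean [sqrt 2]. The divisor [8] is chosen to
    reach this integrable exponent. *)
Let K : R := (4 * (expR 2^-1 * Num.sqrt 2))%R.

Let K0 : (0 <= K)%R.
Proof. by rewrite !mulr_ge0 ?expR_ge0 ?sqrtr_ge0. Qed.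

(** One growth bound covers [z], [z ^ 2 - 1] and the centered cosines and sines of every frequency,
    so that constants derived from it do not depend on [t]. *)
Definition centered_score (h : R -> R) := [/\ measurable_fun setT h,
  (forall z, (`|h z| <= 2 + z ^+ 2)%R) & \int[gamma]_x (h (zeta x))%:E = 0].

(** Centering kills the first-order term of the expansion of the exponential, so the excess over [1]
    is quadratic in [s]. *)
Let exp_moment1 (h : R -> R) (s : R) : (0 <= s <= 1)%R -> centered_score h ->
  \int[gamma]_x (expR (s * (h (zeta x) / 8)))%:E <= (1 + s ^+ 2 * K)%:E.
Proof.
move=> s01 [mh hle h0].
have mhz : measurable_fun setT (h \o zeta).
  by apply: measurableT_comp => //; exact: measurable_zscore.
have mexp : measurable_fun setT (fun x => expR (zeta x ^+ 2 / 4) : R).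
  apply: measurableT_comp => //.
  by apply: measurable_funM => //; apply: measurable_funX; exact: measurable_zscore.
pose b : R := (s ^+ 2 * (4 * expR 2^-1))%R.
have b0 : (0 <= b)%R by apply: mulr_ge0; [exact: sqr_ge0|rewrite mulr_ge0 ?expR_ge0].
have ih : gamma.-integrable setT (EFin \o (fun x => (s / 8 * h (zeta x))%R)).
  apply: (@integrable_normal_prob _ mu sigma sigma0 _ (`|s / 8| * 4)%R).
    by apply: measurable_funM.
  move=> x; rewrite normrM -mulrA ler_wpM2l// (le_trans (hle _))//.
  have := expR_sqr_quarter_ge (zeta x); have := sqr_ge0 (zeta x); lra.
have ie : gamma.-integrable setT (EFin \o (fun x => (b * expR (zeta x ^+ 2 / 4))%R)).
  apply: (@integrable_normal_prob _ mu sigma sigma0 _ b).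
    exact: measurable_funM.
  move=> x; rewrite ger0_norm//; apply: mulr_ge0; first exact: b0.
  exact: expR_ge0.
have i1 : gamma.-integrable setT (EFin \o (fun x : R => 1%R : R)).
  apply: (@integrable_normal_prob _ mu sigma sigma0 _ 1%R) => // x.
  by rewrite mul1r normr1 (le_trans _ (expR_sqr_quarter_ge _))// lerDl divr_ge0 ?sqr_ge0.
have i1h : gamma.-integrable setT (EFin \o (fun x => (1 + s / 8 * h (zeta x))%R)).
  exact: (integrableD measurableT i1 ih).
have le1 x : (expR (s * (h (zeta x) / 8)) <=
    1 + s / 8 * h (zeta x) + b * expR (zeta x ^+ 2 / 4))%R.
  apply: (le_trans (expR_scaled_le _ s01)).
  have -> : (s * (h (zeta x) / 8) = s / 8 * h (zeta x))%R by field.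
  rewrite lerD2l /b -mulrA ler_wpM2l ?sqr_ge0// -mulrA ler_wpM2l// -expRD ler_expR.
  have := hle (zeta x); rewrite normrM (_ : `|8^-1| = 8^-1 :> R)%R; last by rewrite ger0_norm.
  lra.
apply: (@le_trans _ _ (\int[gamma]_x
    ((1 + s / 8 * h (zeta x))%:E + (b * expR (zeta x ^+ 2 / 4))%:E))).
  apply: ge0_le_integral => //.
  - apply/measurable_EFinP; apply: measurableT_comp => //.
    by apply: measurable_funM => //; apply: measurable_funM.
  - apply: emeasurable_funD; apply/measurable_EFinP.
      by apply: measurable_funD => //; apply: measurable_funM.
    exact: measurable_funM.
  - by move=> x _; rewrite -EFinD lee_fin.
rewrite integralD//.
have -> : \int[gamma]_x (1 + s / 8 * h (zeta x))%:E = 1.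
  under eq_integral do rewrite EFinD.
  rewrite integralD//; under [X in _ + X]eq_integral do rewrite EFinM.
  rewrite integralZl//; last first.
    apply: (@integrable_normal_prob _ mu sigma sigma0 _ 4%R) => //.
    move=> x; rewrite (le_trans (hle _))//.
    have := expR_sqr_quarter_ge (zeta x); have := sqr_ge0 (zeta x); lra.
  rewrite h0 mule0 adde0 integral_cst// mul1e.
  exact: integral_normal_pdf.
under eq_integral do rewrite EFinM.
rewrite ge0_integralZl//; last exact/measurable_EFinP.
rewrite integral_normal_prob_expR// -EFinM -EFinD lee_fin.
by rewrite lerD2l /b /K !mulrA.
Qed.

(** With [s = 1 / sqrt n], independence turns the expectation into an [n]-th power, at most
    [(1 + K / n) ^ n <= exp K]. *)
Let exp_moment (h : R -> R) (n : nat) : (0 < n)%N -> centered_score h ->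
  \int[P]_w (expR (normsum h n w / 8))%:E <= (expR K)%:E.
Proof.
move=> n0 ch; have [mh hle h0] := ch.
have sn0 : (0 < Num.sqrt n%:R :> R)%R by rewrite sqrtr_gt0 ltr0n.
pose s : R := ((Num.sqrt n%:R)^-1)%R.
have s2 : (s ^+ 2 = n%:R^-1)%R by rewrite exprVn sqr_sqrtr.
have s01 : (0 <= s <= 1)%R.
  rewrite invr_ge0 ltW//= invf_le1// -[leLHS]sqrtr1 ler_wsqrtr//.
  by rewrite ler1n.
pose f (j : nat) (x : R) : R := expR (s * (h (zeta x) / 8)).
have mf j : measurable_fun setT (f j).
  apply: measurableT_comp => //.
  apply: measurable_funM => //; apply: measurable_funM => //.
  by apply: measurableT_comp => //; exact: measurable_zscore.
pose I := \int[gamma]_x (f 0%N x)%:E.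
have IK : I <= (1 + s ^+ 2 * K)%:E by exact: exp_moment1.
have I0 : 0 <= I by apply: integral_ge0 => x _; rewrite lee_fin expR_ge0.
have Ifin : I \is a fin_num by rewrite ge0_fin_numE// (le_lt_trans IK)// ltry.
have fE j : \int[P]_w (f j (X j w))%:E = (fine I)%:E.
  rewrite fineK// (@integral_law j (fun x => (f j x)%:E))//.
    exact/measurable_EFinP.
  by move=> x; rewrite lee_fin expR_ge0.
have := mutually_independent_integral_prod indX (iota_uniq 0 n) mf
  (fun j x => expR_ge0 _) fE.
have -> : (fun w => (\prod_(j <- iota 0 n) f j (X j w))%:E) =
    (fun w => (expR (normsum h n w / 8))%:E).
  apply/funext => w; congr EFin; rewrite /normsum /f.
  rewrite -(big_mkord xpredT (fun k => h (zeta (X k w)))) /index_iota subn0.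
  elim: (iota 0 n) => [|j l IH]; first by rewrite !big_nil !mul0r expR0.
  rewrite !big_cons IH -expRD; congr expR.
  by rewrite /s; field; rewrite gt_eqF.
move=> ->; rewrite lee_fin big_const_seq count_predT size_iota iter_mulr_1.
have : (fine I <= expR (K / n%:R))%R.
  rewrite -lee_fin fineK// (le_trans IK)// lee_fin s2 mulrC expR_ge1Dx//.
move=> H; have -> : (expR K = expR (K / n%:R) ^+ n)%R.
  by rewrite -expRM_natl; congr expR; rewrite mulrC divfK// pnatr_eq0 -lt0n.
by rewrite lerXn2r// ?nnegrE ?expR_ge0// fine_ge0.
Qed.

(** The power [|v| ^ r] is dominated by [8 ^ r * r ^ r * exp (|v| / 8)], and
    [exp |x| <= exp x + exp (- x)] reduces to the exponential moments of [h] and [- h]. The constant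
    precedes [n] and [h], which gives uniformity in the sample size and in [t]. *)
Lemma normsum_moment (r : nat) : exists2 C : R, (0 <= C)%R &
  forall (n : nat) (h : R -> R), (0 < n)%N -> centered_score h ->
  \int[P]_w (`|normsum h n w| ^+ r)%:E <= C%:E.
Proof.
pose A : R := (8 ^+ r * r%:R ^+ r)%R.
have A0 : (0 <= A)%R by rewrite mulr_ge0 ?exprn_ge0.
exists (A * (expR K + expR K))%R; first by rewrite mulr_ge0 ?addr_ge0 ?expR_ge0.
move=> n h n0 ch; have [mh hle h0] := ch.
have mN : measurable_fun setT (normsum h n) by exact: measurable_normsum.
have chN : centered_score (fun z => - h z)%R.
  split; first exact: measurableT_comp.
    by move=> z; rewrite normrN.
  under eq_integral do rewrite EFinN.
  rewrite integralN ?h0 ?oppe0//; apply: integrable_add_def => //.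
  apply: (@integrable_normal_prob _ mu sigma sigma0 _ 4%R).
    by apply: measurableT_comp => //; exact: measurable_zscore.
  move=> x; rewrite (le_trans (hle _))//.
  have := expR_sqr_quarter_ge (zeta x); have := sqr_ge0 (zeta x); lra.
have mE (c : R) : measurable_fun setT (fun w => expR (c * normsum h n w)).
  by apply: measurableT_comp => //; apply: measurable_funM.
apply: (@le_trans _ _ (\int[P]_w (A%:E * ((expR (8^-1 * normsum h n w))%:E +
    (expR (- 8^-1 * normsum h n w))%:E)))).
  apply: ge0_le_integral => //.
  - by apply/measurable_EFinP; apply: measurable_funX; exact: measurableT_comp.
  - by apply/measurable_EFinP; apply: measurable_funM => //; apply: measurable_funD; exact: mE.
  - move=> w _; rewrite -EFinD -EFinM lee_fin; set v := normsum h n w.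
    have -> : (`|v| = 8 * (8^-1 * `|v|))%R by rewrite mulrA divff ?mul1r.
    rewrite exprMn /A -mulrA ler_wpM2l ?exprn_ge0//.
    have v0 : (0 <= 8^-1 * `|v|)%R by rewrite mulr_ge0.
    apply: (le_trans (exprn_le_expR r v0)); rewrite ler_wpM2l ?exprn_ge0//.
    case: (ger0P v) => [vp|vn].
      by rewrite lerDl expR_ge0.
    by rewrite mulrN mulNr lerDr expR_ge0.
rewrite ge0_integralZl//; last 2 first.
- by apply: emeasurable_funD; apply/measurable_EFinP; exact: mE.
- by move=> w _; rewrite -EFinD lee_fin addr_ge0 ?expR_ge0.
rewrite [leRHS]EFinM; apply: lee_wpmul2l; first by rewrite lee_fin.
rewrite ge0_integralD//; last 2 first.
- by apply/measurable_EFinP; exact: mE.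
- by apply/measurable_EFinP; exact: mE.
rewrite EFinD; apply: leeD.
  apply: le_trans (exp_moment n0 ch); rewrite le_eqVlt; apply/orP; left; apply/eqP.
  by apply: eq_integral => w _; rewrite mulrC.
apply: le_trans (exp_moment n0 chN); rewrite le_eqVlt; apply/orP; left; apply/eqP.
apply: eq_integral => w _; congr (expR _)%:E.
by rewrite /normsum sumrN !mulNr mulrC.
Qed.

End normalized_sums.

(** * The standardized empirical transform *)

Lemma lipschitz1_of_derive (R : realType) (F F1 : R -> R) :
  (forall z : R, is_derive z 1 F (F1 z)) -> (forall z, `|F1 z| <= 1) ->
  forall a b, `|F a - F b| <= `|a - b|.
Proof.
move=> dF F1_le1.
have cF : continuous F.
  by move=> z; apply: differentiable_continuous; apply/derivable1_diffP; case: (dF z).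
suff H a b : a <= b -> `|F a - F b| <= `|a - b|.
  by move=> a b; case: (leP a b) => [/H//|/ltW/H]; rewrite distrC (distrC b).
move=> ab; have [c _ E] := @MVT_segment _ F F1 a b ab
  (fun z _ => dF z) (continuous_subspaceT cF).
by rewrite distrC E normrM (distrC a) ler_piMl.
Qed.

Lemma cos_lipschitz (R : realType) (a b : R) : `|cos a - cos b| <= `|a - b|.
Proof.
apply: (@lipschitz1_of_derive _ cos (fun z => - sin z)).
by move=> z; rewrite normrN sin_max.
Qed.

Lemma sin_lipschitz (R : realType) (a b : R) : `|sin a - sin b| <= `|a - b|.
Proof. by apply: (@lipschitz1_of_derive _ sin cos) => z; exact: cos_max. Qed.

Section complex_norm.
Context (R : realType).
Implicit Types (z : R[i]).
Notation nrm := Normc.normc.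

Lemma normr_normc z : `|z| = (nrm z)%:C%C.
Proof. by []. Qed.

Lemma normc_ge0 z : 0 <= nrm z.
Proof. by case: z => a b; exact: sqrtr_ge0. Qed.

Lemma normc_real (x : R) : nrm (x%:C)%C = `|x|.
Proof. by rewrite /= expr0n addr0 sqrtr_sqr. Qed.

Lemma normc_triangle z z' : nrm (z + z') <= nrm z + nrm z'.
Proof. by rewrite -lecR rmorphD/= -!normr_normc ler_normD. Qed.

Lemma normc_opp z : nrm (- z) = nrm z.
Proof. by apply: complexI; rewrite -!normr_normc normrN. Qed.

Lemma normc_nat n : nrm (n%:R : R[i]) = n%:R.
Proof. by apply: complexI; rewrite -normr_normc normr_nat rmorph_nat. Qed.

Lemma normcX z n : nrm (z ^+ n) = nrm z ^+ n.
Proof. by apply: complexI; rewrite -normr_normc normrX rmorphXn. Qed.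

Lemma normc_le_ReIm (a b : R) : nrm (a +i* b)%C <= `|a| + `|b|.
Proof.
rewrite /= -[leRHS]ger0_norm ?addr_ge0// -sqrtr_sqr ler_wsqrtr//.
rewrite sqrrD !real_normK ?num_real//.
by rewrite lerD2r lerDl mulrn_wge0 ?mulr_ge0.
Qed.

Lemma cexpiD (a b : R) : cexpi a * cexpi b = cexpi (a + b).
Proof. by apply/eqP; rewrite eq_complex /= cosD sinD eqxx/= addrC eqxx. Qed.

Lemma normc_cexpi (a : R) : nrm (cexpi a) = 1.
Proof. by rewrite /= cos2Dsin2 sqrtr1. Qed.

Lemma sum_complex n (a b : 'I_n -> R) :
  \sum_(k < n) (a k +i* b k)%C = ((\sum_(k < n) a k) +i* (\sum_(k < n) b k))%C.
Proof. by elim/big_rec3 : _ => // k x y z _ ->. Qed.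

End complex_norm.

Section standardized.
Context (T : Type) (R : realType) (X : nat -> T -> R) (n : nat) (w : T).
Hypothesis n0 : (0 < n)%N.

Let nR0 : 0 < n%:R :> R. Proof. by rewrite ltr0n. Qed.

(* When [ssd] vanishes the scores are [0], by [x / 0 = 0], and all the [X k w], [k < n],
   are equal; the identities below survive in this degenerate case. *)
Definition std_score (k : nat) : R := (X k w - smean X n w) / ssd X n w.

Lemma ecf_stdE (t : R) : ecf_std X n w t =
  (((\sum_(k < n) cos (t * std_score k)) / n%:R) +i*
   ((\sum_(k < n) sin (t * std_score k)) / n%:R))%C.
Proof.
rewrite /ecf_std /ecf mulrA mulr_sumr.
under eq_bigr do rewrite cexpiD.
have -> : (n%:R^-1 : R[i]) = ((n%:R^-1 : R)%:C)%C by rewrite fmorphV rmorph_nat.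
rewrite sum_complex; apply/eqP; rewrite eq_complex /= !mulr0 subr0 add0r.
apply/andP; split; apply/eqP; congr (_ / _); apply: eq_bigr => k _;
  congr (_ _); rewrite /std_score; ring.
Qed.

Lemma normc_ecf_std_le1 (t : R) : Normc.normc (ecf_std X n w t) <= 1.
Proof.
rewrite /ecf_std Normc.normcM normc_cexpi mul1r /ecf Normc.normcM Normc.normcV.
rewrite normc_nat ler_pdivrMr// mul1r -lecR -normr_normc.
apply: (le_trans (ler_norm_sum _ _ _)).
under eq_bigr do rewrite normr_normc normc_cexpi.
by rewrite -rmorph_sum/= sumr_const card_ord rmorph_nat.
Qed.

(** This average multiplies [|1 - S|] in the Lipschitz comparison. It follows from
    [|x| <= (1 + x ^ 2) / 2], because the squared scores sum to [n], or to [0] when [ssd]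
    vanishes. *)
Lemma sum_std_score_abs_le : \sum_(k < n) `|std_score k| <= n%:R.
Proof.
set s := ssd X n w.
have s2 : s ^+ 2 = (\sum_(k < n) (X k w - smean X n w) ^+ 2) / n%:R.
  by rewrite sqr_sqrtr// divr_ge0// sumr_ge0// => k _; exact: sqr_ge0.
have sq : \sum_(k < n) std_score k ^+ 2 <= n%:R.
  rewrite /std_score -/s; under eq_bigr do rewrite exprMn.
  rewrite -mulr_suml.
  have -> : \sum_(k < n) (X k w - smean X n w) ^+ 2 = s ^+ 2 * n%:R.
    by rewrite s2 divfK// gt_eqF.
  have [->|sN0] := eqVneq s 0; first by rewrite expr0n/= !mul0r.
  by rewrite exprVn mulrAC divff ?mul1r// sqrf_eq0.
apply: (@le_trans _ _ (\sum_(k < n) (1 + std_score k ^+ 2) / 2)).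
  apply: ler_sum => k _; have : 0 <= (1 - `|std_score k|) ^+ 2 by exact: sqr_ge0.
  have : `|std_score k| ^+ 2 = std_score k ^+ 2 by rewrite real_normK ?num_real.
  nra.
rewrite -mulr_suml big_split/= sumr_const card_ord; lra.
Qed.

Variables (mu sigma : R).
Hypothesis sigma0 : 0 < sigma.
Let z k := zscore mu sigma (X k w).
Let zbar := (\sum_(k < n) z k) / n%:R.
Let S := ssd X n w / sigma.

Let zbarE : zbar = (smean X n w - mu) / sigma.
Proof.
rewrite /zbar /z /zscore -mulr_suml sumrB sumr_const card_ord /smean -mulr_natr.
by field; rewrite !gt_eqF.
Qed.

Let S_ge0 : 0 <= S. Proof. by rewrite divr_ge0 ?sqrtr_ge0 ?ltW. Qed.

Let S2E : S ^+ 2 = (\sum_(k < n) (z k - zbar) ^+ 2) / n%:R.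
Proof.
rewrite /S exprMn sqr_sqrtr; last first.
  by rewrite divr_ge0// sumr_ge0// => k _; exact: sqr_ge0.
rewrite mulrAC mulr_suml; congr (_ / _); apply: eq_bigr => k _.
by rewrite -exprMn zbarE /z /zscore; congr (_ ^+ 2); field; rewrite gt_eqF.
Qed.

(** The usual variance decomposition, arranged so that the scale error is expressed by averages of
    the two centered functions [z] and [z ^ 2 - 1]. *)
Let S2E' : 1 - S ^+ 2 = zbar ^+ 2 - (\sum_(k < n) (z k ^+ 2 - 1)) / n%:R.
Proof.
rewrite S2E sumrB sumr_const card_ord -mulr_natr mul1r.
have -> : \sum_(k < n) (z k - zbar) ^+ 2 =
    \sum_(k < n) z k ^+ 2 - (\sum_(k < n) z k) * zbar *+ 2 + n%:R * zbar ^+ 2.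
  rewrite mulr_suml -sumrMnl -sumrB.
  have -> : n%:R * zbar ^+ 2 = \sum_(k < n) zbar ^+ 2.
    by rewrite sumr_const card_ord mulr_natl.
  rewrite -big_split/=.
  by apply: eq_bigr => k _; rewrite sqrrB.
have -> : \sum_(k < n) z k = n%:R * zbar by rewrite mulrC divfK// gt_eqF.
by rewrite -mulr_natr; field; rewrite gt_eqF.
Qed.

Let zE (k : 'I_n) : z k = zbar + S * std_score k.
Proof.
have [s0|s0] := eqVneq (ssd X n w) 0.
  have : S ^+ 2 = 0 by rewrite /S s0 mul0r expr0n.
  rewrite S2E => /eqP; rewrite mulf_eq0 invr_eq0 (gt_eqF nR0) orbF.
  rewrite psumr_eq0; last by move=> i _; exact: sqr_ge0.
  move=> /allP/(_ k (mem_index_enum k))/=; rewrite sqrf_eq0 subr_eq0 => /eqP ->.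
  by rewrite /S s0 !mul0r addr0.
by rewrite zbarE /S /std_score /z /zscore; field; rewrite s0 gt_eqF.
Qed.

Let normsum_gap := `|1 - S| + `|zbar|.

Let transform_gap (F : R -> R) (t : R) :
  (forall a b, `|F a - F b| <= `|a - b|) ->
  `|(\sum_(k < n) F (t * std_score k)) / n%:R - (\sum_(k < n) F (t * z k)) / n%:R|
    <= `|t| * normsum_gap.
Proof.
move=> F_lip; rewrite -mulrBl -sumrB normrM (@ger0_norm _ n%:R^-1) ?invr_ge0//.
rewrite ler_pdivrMr//; apply: (le_trans (ler_norm_sum _ _ _)).
apply: (@le_trans _ _ (\sum_(k < n) `|t| * (`|1 - S| * `|std_score k| + `|zbar|))).
  apply: ler_sum => k _; apply: (le_trans (F_lip _ _)).
  rewrite -mulrBr normrM ler_wpM2l// zE.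
  have -> : std_score k - (zbar + S * std_score k) = (1 - S) * std_score k - zbar by ring.
  by rewrite (le_trans (ler_normB _ _))// normrM.
rewrite -mulr_sumr -mulrA ler_wpM2l// big_split/= -mulr_sumr sumr_const card_ord.
by rewrite /normsum_gap mulrDl [`|zbar| * _]mulr_natr lerD2r ler_wpM2l// sum_std_score_abs_le.
Qed.

Let nsum (h : R -> R) := (\sum_(k < n) h (z k)) / Num.sqrt n%:R.

Let sn0 : 0 < Num.sqrt n%:R :> R. Proof. by rewrite sqrtr_gt0. Qed.

Let nsumE (h : R -> R) : Num.sqrt n%:R * ((\sum_(k < n) h (z k)) / n%:R) = nsum h.
Proof.
rewrite /nsum -{2}(@sqr_sqrtr _ n%:R)//.
by field; rewrite gt_eqF.
Qed.

(** As [S >= 0], the factor [1 + S] is at least [1] and [|1 - S| <= |1 - S ^ 2|], without division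
    by [S]. The term [sqrt n * zbar ^ 2] is enlarged to [n * zbar ^ 2], the square of a normalized
    sum. *)
Let gap_le : Num.sqrt n%:R * normsum_gap <=
  `|nsum (fun x => x ^+ 2 - 1)| + `|nsum id| ^+ 2 + `|nsum id|.
Proof.
rewrite mulrDr -(gtr0_norm sn0) -!normrM.
rewrite -[zbar]/((\sum_(k < n) id (z k)) / n%:R) nsumE lerD2r.
apply: (@le_trans _ _ `|Num.sqrt n%:R * (1 - S ^+ 2)|).
  rewrite !normrM ler_wpM2l//.
  have -> : 1 - S ^+ 2 = (1 - S) * (1 + S) by ring.
  by rewrite normrM ler_peMr// ger0_norm ?addr_ge0// lerDl.
rewrite S2E' mulrBr (le_trans (ler_normB _ _))// addrC.
rewrite (nsumE (fun x => x ^+ 2 - 1)) lerD2l.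
have -> : `|nsum id| ^+ 2 = n%:R * zbar ^+ 2.
  rewrite real_normK ?num_real// -(nsumE id).
  by rewrite -[_ / n%:R]/zbar exprMn sqr_sqrtr.
rewrite normrM (gtr0_norm sn0) (ger0_norm (sqr_ge0 _)).
apply: ler_wpM2r; first exact: sqr_ge0.
have s1 : 1 <= Num.sqrt n%:R :> R by rewrite -[leLHS]sqrtr1 ler_wsqrtr// ler1n.
by rewrite -[leRHS](@sqr_sqrtr _ n%:R)// expr2 ler_peMl// ltW.
Qed.

Let collect_gaps (s g x y v r : R) : s * (r * g) <= r * v ->
  s * ((r * g + x) + (r * g + y)) <= s * x + s * y + 2 * r * v.
Proof. by move=> h; lra. Qed.

(** A pointwise inequality, valid for every sample. Real and imaginary parts are estimated
    separately and each pays one gap, hence the factor [2]. *)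
Lemma normc_Un_le (t : R) : Normc.normc (Un X n w t) <=
  `|nsum (fun x => cos (t * x) - psi0 t)| + `|nsum (fun x => sin (t * x))| +
  2 * `|t| * (`|nsum (fun x => x ^+ 2 - 1)| + `|nsum id| ^+ 2 + `|nsum id|).
Proof.
rewrite /Un Normc.normcM normc_real (gtr0_norm sn0) ecf_stdE.
set a := (X in (X +i* _)%C); set b := (X in (_ +i* X)%C).
have -> : (a +i* b)%C - (psi0 t)%:C%C = ((a - psi0 t) +i* b)%C.
  by apply/eqP; rewrite eq_complex /= subr0 !eqxx.
apply: (le_trans (ler_wpM2l (ltW sn0) (normc_le_ReIm _ _))).
set u := (X in 2 * `|t| * X).
have gt : Num.sqrt n%:R * (`|t| * normsum_gap) <= `|t| * u.
  by rewrite mulrCA ler_wpM2l// gap_le.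
pose c := (\sum_(k < n) cos (t * z k)) / n%:R.
pose e := (\sum_(k < n) sin (t * z k)) / n%:R.
have ac : `|a - c| <= `|t| * normsum_gap.
  by apply: transform_gap; exact: cos_lipschitz.
have be : `|b - e| <= `|t| * normsum_gap.
  by apply: transform_gap; exact: sin_lipschitz.
have -> : `|nsum (fun x => cos (t * x) - psi0 t)| = Num.sqrt n%:R * `|c - psi0 t|.
  rewrite -nsumE normrM (gtr0_norm sn0); congr (_ * `|_|).
  by rewrite sumrB sumr_const card_ord mulrBl -[psi0 t *+ n]mulr_natr mulfK ?gt_eqF.
have -> : `|nsum (fun x => sin (t * x))| = Num.sqrt n%:R * `|e|.
  by rewrite -nsumE normrM (gtr0_norm sn0).
have h1 : `|a - psi0 t| <= `|t| * normsum_gap + `|c - psi0 t|.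
  by rewrite -[X in `|X|](subrKA c) (le_trans (ler_normD _ _))// lerD2r.
have h2 : `|b| <= `|t| * normsum_gap + `|e|.
  by rewrite -{1}[b](subrK e) (le_trans (ler_normD _ _))// lerD2r.
apply: (le_trans (ler_wpM2l (ltW sn0) (lerD h1 h2))).
exact: collect_gaps.
Qed.

End standardized.

(** * Expansion of the discrepancy *)

Section power_taylor.
Context (K : numDomainType) (z a : K).
Hypotheses (z_le1 : `|z| <= 1) (a_le1 : `|a| <= 1).

Lemma norm_exprB_le (j : nat) : `|z ^+ j - a ^+ j| <= j%:R * `|z - a|.
Proof.
elim: j => [|j IH]; first by rewrite subrr normr0 mul0r.
have -> : z ^+ j.+1 - a ^+ j.+1 = z * (z ^+ j - a ^+ j) + (z - a) * a ^+ j.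
  by rewrite !exprS; ring.
apply: (le_trans (ler_normD _ _)); rewrite !normrM.
rewrite -[j.+1]addn1 natrD mulrDl mul1r; apply: lerD.
  by apply: le_trans IH; rewrite ler_piMl.
by rewrite ler_piMr// normrX exprn_ile1.
Qed.

(** The remainders satisfy [R_(j+1) = a * R_j + (z - a) * (z ^ j - a ^ j)], so the constants grow by
    at most [j] at each step, and [j ^ 2 + j <= (j + 1) ^ 2]. *)
Lemma norm_expr_taylor_le (j : nat) :
  `|z ^+ j - a ^+ j - j%:R * a ^+ j.-1 * (z - a)| <= (j ^ 2)%:R * `|z - a| ^+ 2.
Proof.
elim: j => [|j IH]; first by rewrite subrr !mul0r subr0 normr0.
have -> : z ^+ j.+1 - a ^+ j.+1 - j.+1%:R * a ^+ j.+1.-1 * (z - a) =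
    a * (z ^+ j - a ^+ j - j%:R * a ^+ j.-1 * (z - a)) +
    (z - a) * (z ^+ j - a ^+ j).
  case: j {IH} => [|j]; first by rewrite !expr0 !expr1; ring.
  by rewrite /= !exprS -[j.+2]addn1 natrD; ring.
apply: (le_trans (ler_normD _ _)); rewrite !normrM.
have h : `|a| * `|z ^+ j - a ^+ j - j%:R * a ^+ j.-1 * (z - a)| <=
    (j ^ 2)%:R * `|z - a| ^+ 2.
  by apply: le_trans IH; rewrite ler_piMl.
have h2 : `|z - a| * `|z ^+ j - a ^+ j| <= j%:R * `|z - a| ^+ 2.
  by rewrite expr2 mulrCA ler_wpM2l// norm_exprB_le.
apply: (le_trans (lerD h h2)); rewrite -mulrDl ler_wpM2r ?exprn_ge0//.
by rewrite -natrD ler_nat -[j.+1]addn1 sqrnD exp1n muln1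
  -addnA leq_add2l mul2n -addnn addnA leq_addl.
Qed.

End power_taylor.

Section discrepancy_expansion.
Context (T : Type) (R : realType) (X : nat -> T -> R) (n m : nat) (w : T).
Hypotheses (n0 : (0 < n)%N) (m0 : (0 < m)%N).
Notation nrm := (@Normc.normc R).

(** The weights are the Lipschitz constants of [z ^ m.+1] and [z ^ m] on the unit disc, which
    contains both transforms. *)
Definition envelope (t : R) : R :=
  m.+1%:R * nrm (Un X n w (t / Num.sqrt m.+1%:R)) +
  m%:R * nrm (Un X n w (t / Num.sqrt m%:R)).

Lemma envelope_ge0 (t : R) : 0 <= envelope t.
Proof. by rewrite addr_ge0 ?mulr_ge0 ?normc_ge0. Qed.

Lemma psi0_gt0 (t : R) : 0 < psi0 t. Proof. exact: expR_gt0. Qed.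

Lemma psi0_le1 (t : R) : psi0 t <= 1.
Proof.
by rewrite /psi0 -[leRHS]expR0 ler_expR mulNr oppr_le0 divr_ge0 ?sqr_ge0.
Qed.

Lemma psi0_divsqrt (j : nat) (t : R) : (0 < j)%N ->
  psi0 (t / Num.sqrt j%:R) ^+ j = psi0 t.
Proof.
move=> j0; have jR : 0 < j%:R :> R by rewrite ltr0n.
rewrite /psi0 -expRM_natl; congr expR; rewrite exprMn exprVn sqr_sqrtr//.
by field; rewrite gt_eqF.
Qed.

Let sn0 : 0 < Num.sqrt n%:R :> R.
Proof. by rewrite sqrtr_gt0 ltr0n. Qed.

Let zz (j : nat) (t : R) := ecf_std X n w (t / Num.sqrt j%:R).
Let aa (j : nat) (t : R) : R[i] := (psi0 (t / Num.sqrt j%:R))%:C%C.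
Let u (j : nat) (t : R) : R := nrm (Un X n w (t / Num.sqrt j%:R)).

Let uE (j : nat) (t : R) : u j t = Num.sqrt n%:R * nrm (zz j t - aa j t).
Proof. by rewrite /u /Un Normc.normcM normc_real gtr0_norm. Qed.

Let zz_le1 (j : nat) (t : R) : `|zz j t| <= 1.
Proof. by rewrite normr_normc -[1]/((1 : R)%:C%C) lecR normc_ecf_std_le1. Qed.

Let aa_le1 (j : nat) (t : R) : `|aa j t| <= 1.
Proof.
rewrite normr_normc -[1]/((1 : R)%:C%C) lecR normc_real gtr0_norm ?psi0_gt0//.
exact: psi0_le1.
Qed.

Let aaX (j : nat) (t : R) : (0 < j)%N -> aa j t ^+ j = (psi0 t)%:C%C.
Proof. by move=> j0; rewrite /aa -rmorphXn/= psi0_divsqrt. Qed.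

Let first_order (j : nat) (t : R) :
  Num.sqrt n%:R * nrm (zz j t ^+ j - aa j t ^+ j) <= j%:R * u j t.
Proof.
rewrite uE mulrCA ler_wpM2l ?(ltW sn0)// -lecR rmorphM/= rmorph_nat.
exact: norm_exprB_le.
Qed.

(** Each of the two factors [|z - a|] is [u / sqrt n], so one factor [1 / sqrt n] survives the
    normalization. *)
Let second_order (j : nat) (t : R) :
  Num.sqrt n%:R * nrm (zz j t ^+ j - aa j t ^+ j -
    j%:R * aa j t ^+ j.-1 * (zz j t - aa j t)) <=
  (j%:R * u j t) ^+ 2 / Num.sqrt n%:R.
Proof.
have -> : (j%:R * u j t) ^+ 2 / Num.sqrt n%:R =
    Num.sqrt n%:R * ((j ^ 2)%:R * nrm (zz j t - aa j t) ^+ 2).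
  by rewrite uE natrX; field; rewrite gt_eqF.
rewrite ler_wpM2l ?(ltW sn0)// -lecR rmorphM/= rmorph_nat rmorphXn.
exact: norm_expr_taylor_le.
Qed.

Let Dm_decomp (t : R) : Dm X n m w t =
  (zz m.+1 t ^+ m.+1 - aa m.+1 t ^+ m.+1) - (zz m t ^+ m - aa m t ^+ m).
Proof. by rewrite !aaX// /Dm /Sm -/(zz _ _) -/(zz m t); ring. Qed.

Lemma sqrt_Dm_le (t : R) : Num.sqrt n%:R * nrm (Dm X n m w t) <= envelope t.
Proof.
rewrite Dm_decomp.
have h := normc_triangle (zz m.+1 t ^+ m.+1 - aa m.+1 t ^+ m.+1)
  (- (zz m t ^+ m - aa m t ^+ m)).
rewrite normc_opp in h.
apply: (le_trans (ler_wpM2l (ltW sn0) h)); rewrite mulrDr.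
by apply: lerD; exact: first_order.
Qed.

(** Because [psi0 t] is the [j]-th power of [a = psi0 (t / sqrt j)], division by [a] leaves
    [j * a ^ (j - 1)], the derivative of [z ^ j] at [a]. This identifies [psi0 * H] with the linear
    part of [sqrt n * D]. *)
Let Hm_term (j : nat) (t : R) : (0 < j)%N ->
  (psi0 t)%:C%C * (j%:R * (Un X n w (t / Num.sqrt j%:R) / aa j t)) =
  (Num.sqrt n%:R)%:C%C * (j%:R * aa j t ^+ j.-1 * (zz j t - aa j t)).
Proof.
case: j => // j _; rewrite -(@aaX j.+1 t)// /Un -/(zz _ _) -/(aa _ _).
have aN0 : aa j.+1 t != 0 by rewrite /aa fmorph_eq0 gt_eqF ?psi0_gt0.
by rewrite /= exprS; field.
Qed.

Let psi0_Hm (t : R) : (psi0 t)%:C%C * Hm X n m w t = (Num.sqrt n%:R)%:C%C *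
  (m.+1%:R * aa m.+1 t ^+ m * (zz m.+1 t - aa m.+1 t) -
   m%:R * aa m t ^+ m.-1 * (zz m t - aa m t)).
Proof.
rewrite /Hm -/(aa m.+1 t) -/(aa m t) mulrBr Hm_term// Hm_term//.
by rewrite -mulrBr.
Qed.

Let aaX_le1 (j k : nat) (t : R) : nrm (aa j t ^+ k) <= 1.
Proof. by rewrite normcX normc_real gtr0_norm ?psi0_gt0// exprn_ile1 ?psi0_le1// ltW ?psi0_gt0. Qed.

Lemma psi0_Hm_le (t : R) : psi0 t * nrm (Hm X n m w t) <= envelope t.
Proof.
rewrite -{1}(gtr0_norm (psi0_gt0 t)) -normc_real -Normc.normcM psi0_Hm.
rewrite Normc.normcM normc_real (gtr0_norm sn0).
have h := normc_triangle (m.+1%:R * aa m.+1 t ^+ m * (zz m.+1 t - aa m.+1 t))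
  (- (m%:R * aa m t ^+ m.-1 * (zz m t - aa m t))).
rewrite normc_opp in h.
apply: (le_trans (ler_wpM2l (ltW sn0) h)); rewrite mulrDr.
have H j k : Num.sqrt n%:R * nrm (j%:R * aa j t ^+ k * (zz j t - aa j t)) <= j%:R * u j t.
  rewrite uE mulrCA ler_wpM2l ?(ltW sn0)// !Normc.normcM normc_nat -mulrA.
  by rewrite ler_wpM2l// ler_piMl ?normc_ge0.
by apply: lerD; exact: H.
Qed.

Lemma Dm_Hm_gap (t : R) :
  nrm ((Num.sqrt n%:R)%:C%C * Dm X n m w t - (psi0 t)%:C%C * Hm X n m w t) <=
  envelope t ^+ 2 / Num.sqrt n%:R.
Proof.
rewrite psi0_Hm -mulrBr Normc.normcM normc_real (gtr0_norm sn0) Dm_decomp.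
set A := (X in X - _ - _); set B := (X in _ - X - _).
set C := (X in _ - (X - _)); set E := (X in _ - (_ - X)).
have -> : A - B - (C - E) = (A - C) + (- (B - E)) by ring.
apply: (le_trans (ler_wpM2l (ltW sn0) (normc_triangle _ _))).
rewrite normc_opp mulrDr.
apply: (le_trans (lerD (second_order m.+1 t) (second_order m t))).
rewrite -mulrDl ler_wpM2r ?invr_ge0 ?(ltW sn0)// /envelope -/(u m.+1 t) -/(u m t).
(* The two remainders add up to a sum of squares, which the square of the sum dominates since its
   cross term is nonnegative. *)
rewrite [leRHS]sqrrD -addrA lerD2l lerDr mulrn_wge0// mulr_ge0 ?mulr_ge0 ?normc_ge0//.
Qed.

Lemma sqmod_Dm_le (t : R) : n%:R * sqmod (Dm X n m w t) <= envelope t ^+ 2.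
Proof.
rewrite /sqmod -[n%:R in leLHS](@sqr_sqrtr _ n%:R)// -exprMn.
by rewrite lerXn2r ?nnegrE ?mulr_ge0 ?normc_ge0 ?(ltW sn0) ?envelope_ge0 ?sqrt_Dm_le.
Qed.

Lemma sqmod_Hm_le (t : R) : psi0 t ^+ 2 * sqmod (Hm X n m w t) <= envelope t ^+ 2.
Proof.
rewrite /sqmod -exprMn.
by rewrite lerXn2r ?nnegrE ?mulr_ge0 ?normc_ge0 ?(ltW (psi0_gt0 _)) ?envelope_ge0 ?psi0_Hm_le.
Qed.

(** Factor the difference of squares: the difference of the norms is at most [envelope ^ 2 / sqrt n]
    by the reverse triangle inequality, and their sum at most [2 * envelope]. *)
Lemma sqmod_Dm_Hm_gap (t : R) :
  `|n%:R * sqmod (Dm X n m w t) - psi0 t ^+ 2 * sqmod (Hm X n m w t)| <=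
  2 * envelope t ^+ 3 / Num.sqrt n%:R.
Proof.
rewrite /sqmod -[n%:R in leLHS](@sqr_sqrtr _ n%:R)// -!exprMn subr_sqr normrM.
have h1 : `|Num.sqrt n%:R * nrm (Dm X n m w t) - psi0 t * nrm (Hm X n m w t)| <=
    envelope t ^+ 2 / Num.sqrt n%:R.
  apply: le_trans (Dm_Hm_gap t).
  set p := (Num.sqrt n%:R)%:C%C * _; set q := (psi0 t)%:C%C * _.
  have -> : Num.sqrt n%:R * nrm (Dm X n m w t) = nrm p.
    by rewrite Normc.normcM normc_real gtr0_norm.
  have -> : psi0 t * nrm (Hm X n m w t) = nrm q.
    by rewrite Normc.normcM normc_real gtr0_norm ?psi0_gt0.
  have hp := normc_triangle (p - q) q; rewrite subrK in hp.
  have hq := normc_triangle (q - p) p; rewrite subrK -opprB normc_opp in hq.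
  by rewrite ler_norml; apply/andP; split; lra.
have h2 : `|Num.sqrt n%:R * nrm (Dm X n m w t) + psi0 t * nrm (Hm X n m w t)| <=
    2 * envelope t.
  have := sqrt_Dm_le t; have := psi0_Hm_le t.
  rewrite ger0_norm ?addr_ge0 ?mulr_ge0 ?normc_ge0 ?(ltW sn0) ?(ltW (psi0_gt0 _))//.
  lra.
apply: (le_trans (ler_pM (normr_ge0 _) (normr_ge0 _) h1 h2)).
rewrite le_eqVlt; apply/orP; left; apply/eqP.
by field; rewrite gt_eqF.
Qed.

End discrepancy_expansion.

(** * Measurability *)

Section complex_measurability.
Context d (A : measurableType d) (R : realType).

Definition cmeasurable (f : A -> R[i]) :=
  measurable_fun setT (fun a => complex.Re (f a)) /\
  measurable_fun setT (fun a => complex.Im (f a)).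

Lemma cmeasurableD f g :
  cmeasurable f -> cmeasurable g -> cmeasurable (fun a => f a + g a).
Proof.
move=> [f1 f2] [g1 g2]; split.
  rewrite (_ : (fun _ => _) = (fun a => complex.Re (f a) + complex.Re (g a))); last first.
    by apply/funext => a; case: (f a); case: (g a).
  exact: measurable_funD.
rewrite (_ : (fun _ => _) = (fun a => complex.Im (f a) + complex.Im (g a))); last first.
  by apply/funext => a; case: (f a); case: (g a).
exact: measurable_funD.
Qed.

Lemma cmeasurableM f g :
  cmeasurable f -> cmeasurable g -> cmeasurable (fun a => f a * g a).
Proof.
move=> [f1 f2] [g1 g2]; split.
  rewrite (_ : (fun _ => _) = (fun a => complex.Re (f a) * complex.Re (g a) -
      complex.Im (f a) * complex.Im (g a))); last first.
    by apply/funext => a; case: (f a) => ? ?; case: (g a).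
  by apply: measurable_funB; exact: measurable_funM.
rewrite (_ : (fun _ => _) = (fun a => complex.Re (f a) * complex.Im (g a) +
    complex.Im (f a) * complex.Re (g a))); last first.
  by apply/funext => a; case: (f a) => ? ?; case: (g a).
by apply: measurable_funD; exact: measurable_funM.
Qed.

Lemma cmeasurable_real (f : A -> R) :
  measurable_fun setT f -> cmeasurable (fun a => (f a)%:C%C).
Proof. by move=> mf; split. Qed.

Lemma cmeasurable_cst (c : R[i]) : cmeasurable (fun=> c).
Proof. by split. Qed.

Lemma cmeasurableB f g :
  cmeasurable f -> cmeasurable g -> cmeasurable (fun a => f a - g a).
Proof.
move=> cf cg; rewrite (_ : (fun _ => _) = (fun a => f a + (-1) * g a)).
  by apply: cmeasurableD => //; apply: cmeasurableM => //; exact: cmeasurable_cst.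
by apply/funext => a; rewrite mulN1r.
Qed.

Lemma cmeasurableX f k : cmeasurable f -> cmeasurable (fun a => f a ^+ k).
Proof.
move=> cf; elim: k => [|k IH]; first exact: cmeasurable_cst.
rewrite (_ : (fun _ => _) = (fun a => f a * f a ^+ k)).
  exact: cmeasurableM.
by apply/funext => a; rewrite exprS.
Qed.

Lemma cmeasurable_sum k (f : 'I_k -> A -> R[i]) :
  (forall i, cmeasurable (f i)) -> cmeasurable (fun a => \sum_(i < k) f i a).
Proof.
move=> cf; elim: (index_enum _) => [|i s IH].
  rewrite (_ : (fun _ => _) = (fun=> 0)); first exact: cmeasurable_cst.
  by apply/funext => a; rewrite big_nil.
rewrite (_ : (fun _ => _) = (fun a => f i a + \sum_(j <- s) f j a)).
  exact: cmeasurableD.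
by apply/funext => a; rewrite big_cons.
Qed.

Lemma cmeasurable_cexpi (f : A -> R) :
  measurable_fun setT f -> cmeasurable (fun a => cexpi (f a)).
Proof.
move=> mf; split; apply: measurableT_comp => //; apply: continuous_measurable_fun.
  exact: continuous_cos.
exact: continuous_sin.
Qed.

Lemma measurable_sqmod f :
  cmeasurable f -> measurable_fun setT (fun a => sqmod (f a)).
Proof.
move=> [f1 f2]; rewrite (_ : (fun _ => _) =
    (fun a => complex.Re (f a) ^+ 2 + complex.Im (f a) ^+ 2)); last first.
  apply/funext => a; rewrite /sqmod; case: (f a) => x y.
  by rewrite sqr_sqrtr ?addr_ge0 ?sqr_ge0.
by apply: measurable_funD; exact: measurable_funX.
Qed.

Lemma measurable_sqrt_comp (f : A -> R) :
  measurable_fun setT f -> measurable_fun setT (fun a => Num.sqrt (f a)).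
Proof.
move=> mf; apply: measurableT_comp => //.
apply: continuous_measurable_fun; exact: sqrt_continuous.
Qed.

Lemma measurable_normc f :
  cmeasurable f -> measurable_fun setT (fun a => Normc.normc (f a)).
Proof.
move=> cf; rewrite (_ : (fun _ => _) = (fun a => Num.sqrt (sqmod (f a)))).
  by apply: measurable_sqrt_comp; exact: measurable_sqmod.
by apply/funext => a; rewrite /sqmod sqrtr_sqr ger0_norm ?normc_ge0.
Qed.

End complex_measurability.

Section statistics_measurability.
Context d d' (A : measurableType d') (T : measurableType d) (R : realType).
Variables (X : nat -> T -> R) (n : nat) (pi : A -> T) (tau : A -> R).
Hypotheses (mX : forall k, measurable_fun setT (X k)).
Hypotheses (mpi : measurable_fun setT pi) (mtau : measurable_fun setT tau).

Let mXpi k : measurable_fun setT (fun a => X k (pi a)).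
Proof. exact: measurableT_comp. Qed.

Let msmean : measurable_fun setT (fun a => smean X n (pi a)).
Proof. by apply: measurable_funM => //; exact: measurable_sum. Qed.

Let mssd : measurable_fun setT (fun a => ssd X n (pi a)).
Proof.
apply: measurable_sqrt_comp; apply: measurable_funM => //.
apply: measurable_sum => k; apply: measurable_funX; exact: measurable_funB.
Qed.

(** [ssd] may vanish, where inversion is not continuous. On nonnegative reals, [0] included,
    inversion agrees with the measurable function [powR _ (-1)]. *)
Let mssdV : measurable_fun setT (fun a => (ssd X n (pi a))^-1).
Proof.
rewrite (_ : (fun _ => _) = (fun a => powR (ssd X n (pi a)) (-1))).
  by apply: (measurableT_comp (@measurable_powR R (-1))); exact: mssd.
by apply/funext => a; rewrite powR_inv1 ?sqrtr_ge0.
Qed.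

(** Sample point and time are both functions of a parameter [a]: projections give joint
    measurability for Tonelli, and the identity with a constant gives measurability at a fixed
    time. *)
Lemma cmeasurable_ecf_std : cmeasurable (fun a => ecf_std X n (pi a) (tau a)).
Proof.
apply: cmeasurableM.
  apply: cmeasurable_cexpi; apply: measurableT_comp => //.
  by apply: measurable_funM => //; exact: measurable_funM.
apply: cmeasurableM; last exact: cmeasurable_cst.
apply: cmeasurable_sum => k; apply: cmeasurable_cexpi.
by apply: measurable_funM => //; exact: measurable_funM.
Qed.

Lemma measurable_psi0_comp (f : A -> R) :
  measurable_fun setT f -> measurable_fun setT (fun a => psi0 (f a)).
Proof.
move=> mf; rewrite /psi0; apply: (measurableT_comp (@measurable_expR R)).
apply: measurable_funM => //.
by apply: measurableT_comp => //; exact: measurable_funX.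
Qed.

Lemma cmeasurable_Un : cmeasurable (fun a => Un X n (pi a) (tau a)).
Proof.
apply: cmeasurableM; first exact: cmeasurable_cst.
apply: cmeasurableB; first exact: cmeasurable_ecf_std.
by apply: cmeasurable_real; exact: measurable_psi0_comp.
Qed.

End statistics_measurability.

Section discrepancy_measurability.
Context d d' (A : measurableType d') (T : measurableType d) (R : realType).
Variables (X : nat -> T -> R) (n m : nat) (pi : A -> T) (tau : A -> R).
Hypotheses (mX : forall k, measurable_fun setT (X k)).
Hypotheses (mpi : measurable_fun setT pi) (mtau : measurable_fun setT tau).

Let mtaud (j : nat) : measurable_fun setT (fun a => tau a / Num.sqrt j%:R).
Proof. exact: measurable_funM. Qed.

Lemma measurable_sqmod_Dm :
  measurable_fun setT (fun a => sqmod (Dm X n m (pi a) (tau a))).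
Proof.
apply: measurable_sqmod; apply: cmeasurableB; apply: cmeasurableX;
  exact: cmeasurable_ecf_std.
Qed.

Lemma measurable_sqmod_Hm :
  measurable_fun setT (fun a => sqmod (Hm X n m (pi a) (tau a))).
Proof.
apply: measurable_sqmod.
have H j : cmeasurable (fun a => j%:R * (Un X n (pi a) (tau a / Num.sqrt j%:R) /
    (psi0 (tau a / Num.sqrt j%:R))%:C%C)).
  apply: cmeasurableM; first exact: cmeasurable_cst.
  apply: cmeasurableM; first exact: cmeasurable_Un.
  rewrite (_ : (fun _ => _) = (fun a => ((psi0 (tau a / Num.sqrt j%:R))^-1)%:C%C)).
    apply: cmeasurable_real.
    rewrite (_ : (fun _ => _) = (fun a => powR (psi0 (tau a / Num.sqrt j%:R)) (-1))).
      apply: (measurableT_comp (@measurable_powR R (-1))).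
      exact: measurable_psi0_comp.
    by apply/funext => a; rewrite powR_inv1 ?(ltW (psi0_gt0 _)).
  by apply/funext => a; rewrite fmorphV.
exact: cmeasurableB.
Qed.

Lemma measurable_envelope :
  measurable_fun setT (fun a => envelope X n m (pi a) (tau a)).
Proof.
by apply: measurable_funD; apply: measurable_funM => //;
  apply: measurable_normc; exact: cmeasurable_Un.
Qed.

End discrepancy_measurability.

(** * Integrals over the window *)

Lemma markov_bound d (T : measurableType d) (R : realType) (P : probability T R)
    (Z : T -> R) (c eps : R) :
  measurable_fun setT Z -> (forall w, 0 <= Z w) -> 0 < eps ->
  (\int[P]_w (Z w)%:E <= c%:E)%E -> (P [set w | (eps < Z w)%R] <= (c / eps)%:E)%E.
Proof.
move=> mZ Z0 eps0 Zc.
have mA : measurable [set w | eps < Z w].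
  have -> : [set w | eps < Z w] = Z @^-1` [set` `]eps, +oo[].
    by apply/seteqP; split=> w /=; rewrite in_itv/= andbT.
  by rewrite -[X in measurable X]setTI; apply: mZ => //; exact: measurable_itv.
rewrite -[X in (P X <= _)%E]setIT -integral_indic// mulrC EFinM.
apply: (@le_trans _ _ (\int[P]_w ((eps^-1)%:E * (Z w)%:E))%E).
  apply: ge0_le_integral => //.
  - by apply/measurable_EFinP; exact: measurable_indic.
  - by apply/measurable_EFinP; exact: measurable_funM.
  - move=> w _; rewrite -EFinM lee_fin indicE.
    case: (boolP (w \in _)) => [/set_mem/= h|_].
      by rewrite -ler_pdivrMl ?invr_gt0// invrK mulr1 ltW.
    by apply: mulr_ge0 => //; rewrite invr_ge0 ltW.
rewrite ge0_integralZl//; last 3 first.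
- exact/measurable_EFinP.
- by move=> w _; rewrite lee_fin.
- by rewrite lee_fin invr_ge0 ltW.
by apply: lee_wpmul2l => //; rewrite lee_fin invr_ge0 ltW.
Qed.

Section time_integral.
Context d (T : measurableType d) (R : realType) (P : probability T R).
Notation leb := (@lebesgue_measure R).
Variables (TT : R) (f : T -> R -> R).
Hypothesis TT0 : 0 <= TT.
Hypothesis mf : measurable_fun setT (fun p : T * R => f p.1 p.2).
Hypothesis f0 : forall w t, 0 <= f w t.
Variable B : R.
Hypothesis fB : forall w t, f w t <= B.

Definition time_integral (w : T) : R := \int[leb]_(t in `[(- TT)%R, TT]) f w t.

Let mD : measurable (`[(- TT)%R, TT]%classic : set (measurableTypeR R)).
Proof. exact: measurable_itv. Qed.

Lemma lebesgue_measure_window : leb `[- TT, TT] = (2 * TT)%:E.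
Proof.
rewrite lebesgue_measure_itv/= lte_fin; case: ltP => h.
  by rewrite -EFinB; congr EFin; lra.
by congr EFin; move: TT0 h => ? ?; lra.
Qed.

Let mfw (w : T) : measurable_fun setT (f w).
Proof.
have h : measurable_fun setT (fun t : R => (w, t)) by exact: measurable_pair1.
exact: (measurableT_comp mf h).
Qed.

Lemma integrable_window (w : T) : leb.-integrable `[- TT, TT] (EFin \o f w).
Proof.
apply: measurable_bounded_integrable => //.
- by rewrite /= lebesgue_measure_window ltry.
- by apply: measurable_funTS; exact: mfw.
- exists B; split; first exact: num_real.
  by move=> x Bx t _ /=; rewrite ger0_norm// (le_trans (fB _ _))// ltW.
Qed.

Lemma time_integralE (w : T) :
  (time_integral w)%:E = (\int[leb]_(t in `[(- TT)%R, TT]) (f w t)%:E)%E.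
Proof. by rewrite fineK//; apply: integrable_fin_num => //; exact: integrable_window. Qed.

(** The indicator carries the window into the integrand, so that Tonelli applies on the whole
    product space. *)
Let g (p : T * measurableTypeR R) : \bar R := (f p.1 p.2 * \1_`[- TT, TT] p.2)%:E.

Let mg : measurable_fun setT g.
Proof.
apply/measurable_EFinP; apply: measurable_funM => //.
apply: measurableT_comp; last exact: measurable_snd.
exact: measurable_indic.
Qed.

Let g0 p : (0 <= g p)%E.
Proof. by rewrite lee_fin mulr_ge0// indicE. Qed.

Let integral_gE (w : T) :
  (\int[leb]_(t in `[(- TT)%R, TT]) (f w t)%:E = \int[leb]_t g (w, t))%E.
Proof.
rewrite integral_mkcond; apply: eq_integral => t _; rewrite patchE /g /= indicE.
by case: ifP => _; rewrite ?mulr1 ?mulr0.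
Qed.

Lemma measurable_time_integral : measurable_fun setT time_integral.
Proof.
rewrite (_ : time_integral = fun w => fine (\int[leb]_t g (w, t))%E); last first.
  by apply/funext => w; rewrite /time_integral /Rintegral integral_gE.
apply: measurableT_comp => //.
exact: (measurable_fun_fubini_tonelli_F (m2 := leb)).
Qed.

Lemma integral_time_integral_le (c : R) :
  (forall t, (`|t| <= TT)%R -> \int[P]_w (f w t)%:E <= c%:E)%E ->
  (\int[P]_w (time_integral w)%:E <= (c * (2 * TT))%:E)%E.
Proof.
move=> fc.
rewrite (_ : \int[P]_w _ = \int[P]_w \int[leb]_t g (w, t))%E; last first.
  by apply: eq_integral => w _; rewrite time_integralE integral_gE.
rewrite fubini_tonelli//.
apply: (@le_trans _ _ (\int[leb]_(t in `[(- TT)%R, TT]) cst c%:E t)%E); last first.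
  by rewrite integral_cst//= lebesgue_measure_window.
rewrite [leRHS]integral_mkcond; apply: ge0_le_integral => //.
- by move=> t _; apply: integral_ge0.
- exact: (measurable_fun_fubini_tonelli_G (m1 := P)).
- by apply/(measurable_restrictT _ _).1 => //; exact: measurable_cst.
- move=> t _; rewrite patchE /g /= indicE; case: ifPn => h.
    under eq_integral do rewrite mulr1.
    by apply: fc; move/set_mem : h; rewrite /= in_itv/= ler_norml.
  by under eq_integral do rewrite mulr0; rewrite integral0.
Qed.

End time_integral.

(* The tangent line of [x ^ q] at [y], for Jensen's inequality. *)
Lemma expr_tangent_le (R : realDomainType) (q : nat) (x y : R) : 0 <= x -> 0 <= y ->
  y ^+ q + q%:R * y ^+ q.-1 * (x - y) <= x ^+ q.
Proof.
move=> x0 y0; rewrite -subr_ge0.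
elim: q => [|q IH]; first by rewrite !expr0 !mul0r addr0 subrr.
have -> : x ^+ q.+1 - (y ^+ q.+1 + q.+1%:R * y ^+ q.+1.-1 * (x - y)) =
  y * (x ^+ q - (y ^+ q + q%:R * y ^+ q.-1 * (x - y))) + (x - y) * (x ^+ q - y ^+ q).
  case: q {IH} => [|q]; first by rewrite !expr0 !expr1; ring.
  by rewrite /= !exprS -[q.+2]addn1 natrD; ring.
apply: addr_ge0; first exact: mulr_ge0.
have [xy|yx] := leP x y.
  by rewrite -mulrNN mulr_ge0// oppr_ge0 subr_le0// lerXn2r.
by rewrite mulr_ge0// subr_ge0 ?lerXn2r// ltW.
Qed.

(** A sum of two terms is at most twice the larger, which costs a factor [2 ^ r] per element of the
    list; this crude constant is enough. Positivity of [r] handles the empty list, where [0 ^ r]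
    must be [0]. *)
Lemma expr_sum_le (R : realDomainType) (r : nat) (s : seq R) : (0 < r)%N ->
  (forall x, x \in s -> 0 <= x) ->
  (\sum_(x <- s) x) ^+ r <= 2 ^+ (r * size s) * \sum_(x <- s) x ^+ r.
Proof.
move=> r0; elim: s => [|a s IH] s0.
  by rewrite !big_nil expr0n (gtn_eqF r0) mulr0.
rewrite !big_cons; set b := \sum_(x <- s) x.
have a0 : 0 <= a by apply: s0; rewrite mem_head.
have s0' x : x \in s -> 0 <= x by move=> xs; apply: s0; rewrite in_cons xs orbT.
have b0 : 0 <= b by rewrite /b big_seq sumr_ge0.
have ar : 0 <= a ^+ r by rewrite exprn_ge0.
have br : 0 <= b ^+ r by rewrite exprn_ge0.
apply: (@le_trans _ _ (2 ^+ r * (a ^+ r + b ^+ r))).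
  have [ab|ba] := leP a b.
    apply: (@le_trans _ _ ((2 * b) ^+ r)).
      by rewrite lerXn2r ?nnegrE ?addr_ge0 ?mulr_ge0//; lra.
    by rewrite exprMn ler_wpM2l ?exprn_ge0// lerDr.
  apply: (@le_trans _ _ ((2 * a) ^+ r)).
    by rewrite lerXn2r ?nnegrE ?addr_ge0 ?mulr_ge0//; lra.
  by rewrite exprMn ler_wpM2l ?exprn_ge0// lerDl.
rewrite /= mulnS exprD -mulrA ler_wpM2l ?exprn_ge0// mulrDr; apply: lerD.
  by rewrite ler_peMl// exprn_ege1// ler1n.
exact: IH.
Qed.

(** * Moments of the discrepancy *)

Section envelope_moments.
Context d (T : measurableType d) (R : realType) (P : probability T R).
Variables (X : nat -> {RV P >-> R}) (mu sigma : R).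
Hypothesis sigma0 : 0 < sigma.
Hypothesis lawX : forall k A, measurable A -> P (X k @^-1` A) = normal_prob mu sigma A.
Hypothesis indX : mutually_independent P (fun k => (X k : T -> R)).
Notation XX := (fun k => (X k : T -> R)).
Variables (TT : R) (m : nat).
Hypotheses (TT0 : 0 < TT) (m0 : (0 < m)%N).

Let centered_cos (t : R) : centered_score mu sigma (fun x => cos (t * x) - psi0 t).
Proof.
split.
- apply: measurable_funB => //; apply: measurableT_comp; last exact: measurable_funM.
  by apply: continuous_measurable_fun; exact: continuous_cos.
- move=> z; apply: (le_trans (ler_normB _ _)).
  have := cos_max (t * z); have := psi0_le1 t; have := psi0_gt0 t; have := sqr_ge0 z.
  by move=> z2 p0 p1 c1; rewrite (gtr0_norm p0); lra.
- exact: normal_cos_centered.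
Qed.

Let centered_sin (t : R) : centered_score mu sigma (fun x => sin (t * x)).
Proof.
split.
- apply: measurableT_comp; last exact: measurable_funM.
  by apply: continuous_measurable_fun; exact: continuous_sin.
- by move=> z; have := sin_max (t * z); have := sqr_ge0 z; lra.
- exact: normal_sin_centered.
Qed.

Let centered_id : centered_score mu sigma id.
Proof.
split=> //; last exact: normal_mean0.
move=> z; have : 0 <= (1 - `|z|) ^+ 2 by exact: sqr_ge0.
have : `|z| ^+ 2 = z ^+ 2 by rewrite real_normK ?num_real.
nra.
Qed.

Let centered_sqr : centered_score mu sigma (fun x => x ^+ 2 - 1).
Proof.
split; last exact: normal_variance1.
- by apply: measurable_funB => //; exact: measurable_funX.
- move=> z; apply: (le_trans (ler_normB _ _)); rewrite normr1 ger0_norm ?sqr_ge0//.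
  lra.
Qed.

Local Notation ns := (normsum X mu sigma).

(** The normalized sums occurring in the bounds of [Un] at the two scales; the last three come from
    standardization and are shared. The square of the mean is an entry of its own, so its [r]-th
    moment is a moment of order [2 * r]. *)
Let terms (n : nat) (t : R) : seq (T -> R) :=
  let u j := t / Num.sqrt j%:R in
  [:: (fun w => `|ns (fun x => cos (u m.+1 * x) - psi0 (u m.+1)) n w|);
      (fun w => `|ns (fun x => sin (u m.+1 * x)) n w|);
      (fun w => `|ns (fun x => cos (u m * x) - psi0 (u m)) n w|);
      (fun w => `|ns (fun x => sin (u m * x)) n w|);
      (fun w => `|ns (fun x => x ^+ 2 - 1) n w|);
      (fun w => `|ns id n w| ^+ 2);
      (fun w => `|ns id n w|)].

(** The larger weight of the envelope, times [1] for the transform terms plus [2 * TT] for the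
    standardization terms at each of the two scales. *)
Let K : R := m.+1%:R * (1 + 4 * TT).

Let u_le (j : nat) (t : R) : (0 < j)%N -> `|t| <= TT -> `|t / Num.sqrt j%:R| <= TT.
Proof.
move=> j0 tT; apply: le_trans tT; rewrite normrM ler_piMr// normfV
  invf_le1 ?normr_gt0 ?gt_eqF ?sqrtr_gt0 ?ltr0n//.
by rewrite ger0_norm ?sqrtr_ge0// -[leLHS]sqrtr1 ler_wsqrtr// ler1n.
Qed.

Let envelope_le (n : nat) (w : T) (t : R) : (0 < n)%N -> `|t| <= TT ->
  envelope XX n m w t <= K * \sum_(f <- terms n t) f w.
Proof.
move=> n0 tT; rewrite /terms !big_cons big_nil addr0.
have u1 := u_le (ltn0Sn m) tT; have u2 := u_le m0 tT.
pose t1 := t / Num.sqrt m.+1%:R; pose t2 := t / Num.sqrt m%:R.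
pose a1 := Normc.normc (Un XX n w t1); pose a2 := Normc.normc (Un XX n w t2).
pose c1 := `|ns (fun x => cos (t1 * x) - psi0 t1) n w|.
pose c2 := `|ns (fun x => cos (t2 * x) - psi0 t2) n w|.
pose s1 := `|ns (fun x => sin (t1 * x)) n w|.
pose s2 := `|ns (fun x => sin (t2 * x)) n w|.
pose q := `|ns (fun x => x ^+ 2 - 1) n w|; pose l := `|ns id n w|.
have h1 : a1 <= c1 + s1 + 2 * `|t1| * (q + l ^+ 2 + l) :=
  normc_Un_le XX w n0 mu sigma0 t1.
have h2 : a2 <= c2 + s2 + 2 * `|t2| * (q + l ^+ 2 + l) :=
  normc_Un_le XX w n0 mu sigma0 t2.
rewrite /envelope -/t1 -/t2 -/a1 -/a2 -/c1 -/c2 -/s1 -/s2 -/q -/l.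
have c10 : 0 <= c1 by exact: normr_ge0.
have s10 : 0 <= s1 by exact: normr_ge0.
have c20 : 0 <= c2 by exact: normr_ge0.
have s20 : 0 <= s2 by exact: normr_ge0.
have q0 : 0 <= q by exact: normr_ge0.
have l0 : 0 <= l by exact: normr_ge0.
have l20 : 0 <= l ^+ 2 by exact: sqr_ge0.
have a10 : 0 <= a1 by exact: normc_ge0.
have a20 : 0 <= a2 by exact: normc_ge0.
rewrite -/t1 -/t2 in u1 u2.
clearbody a1 a2 c1 c2 s1 s2 q l t1 t2.
have V0 : 0 <= q + l ^+ 2 + l by rewrite !addr_ge0.
have h1' : a1 <= c1 + s1 + 2 * TT * (q + l ^+ 2 + l).
  by apply: (le_trans h1); rewrite lerD2l ler_wpM2r// ler_wpM2l.
have h2' : a2 <= c2 + s2 + 2 * TT * (q + l ^+ 2 + l).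
  by apply: (le_trans h2); rewrite lerD2l ler_wpM2r// ler_wpM2l.
have mm : m%:R <= m.+1%:R :> R by rewrite ler_nat.
apply: (@le_trans _ _ (m.+1%:R * (a1 + a2))).
  by rewrite mulrDr lerD2l ler_wpM2r.
rewrite /K -mulrA ler_wpM2l//.
have TT0' := ltW TT0.
(* Expanding [1 + 4 * TT] against the whole sum creates surplus products of [TT] with the cosine and
   sine terms; their signs have to be known. *)
have := mulr_ge0 TT0' c10; have := mulr_ge0 TT0' s10.
have := mulr_ge0 TT0' c20; have := mulr_ge0 TT0' s20.
nra.
Qed.

Lemma envelope_moment (r : nat) : (0 < r)%N -> exists2 C : R, 0 <= C &
  forall (n : nat) (t : R), (0 < n)%N -> `|t| <= TT ->
  (\int[P]_w (envelope XX n m w t ^+ r)%:E <= C%:E)%E.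
Proof.
move=> r0.
have [C1 C10 H1] := normsum_moment sigma0 lawX indX r.
have [C2 C20 H2] := normsum_moment sigma0 lawX indX (2 * r).
pose C := Num.max C1 C2.
have C1C : C1 <= C by rewrite le_max lexx.
have C2C : C2 <= C by rewrite le_max lexx orbT.
have K0 : 0 <= K by rewrite mulr_ge0// addr_ge0// mulr_ge0// ltW.
(* The [7] is the length of [terms]: the sum of its entries is raised to the power [r] by
   [expr_sum_le]. *)
pose L : R := K ^+ r * 2 ^+ (r * 7).
have L0 : 0 <= L by rewrite mulr_ge0// exprn_ge0.
exists (L * (C *+ 7)).
  by rewrite mulr_ge0// mulrn_wge0// (le_trans C10).
move=> n t n0 tT.
have mns h : centered_score mu sigma h -> measurable_fun setT (fun w => `|ns h n w|).
  by move=> [mh _ _]; apply: measurableT_comp => //; exact: measurable_normsum.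
have termsP : forall f, List.In f (terms n t) -> [/\ measurable_fun setT f,
    (forall w, 0 <= f w) & (\int[P]_w (f w ^+ r)%:E <= C%:E)%E].
  move=> f /=.
  have one h : centered_score mu sigma h ->
      [/\ measurable_fun setT (fun w => `|ns h n w|),
      (forall w, 0 <= `|ns h n w|) & (\int[P]_w (`|ns h n w| ^+ r)%:E <= C%:E)%E].
    move=> ch; split; [exact: mns|by move=> w; exact: normr_ge0|].
    by apply: (le_trans (H1 n h n0 ch)); rewrite lee_fin.
  move=> [<-|[<-|[<-|[<-|[<-|[<-|[<-|[]]]]]]]].
  - exact: one.
  - exact: one.
  - exact: one.
  - exact: one.
  - exact: one.
  - split; first by apply: measurable_funX; exact: mns.
      by move=> w; exact: sqr_ge0.
    under eq_integral do rewrite -exprM.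
    by apply: (le_trans (H2 n id n0 centered_id)); rewrite lee_fin.
  - exact: one.
have menv : measurable_fun setT (fun w => envelope XX n m w t).
  by apply: (@measurable_envelope _ _ T T R XX n m id (cst t)).
have sum_le : forall s : seq (T -> R),
    (forall f, List.In f s -> [/\ measurable_fun setT f,
      (forall w, 0 <= f w) & (\int[P]_w (f w ^+ r)%:E <= C%:E)%E]) ->
    measurable_fun setT (fun w => \sum_(f <- s) f w ^+ r) /\
    (\int[P]_w (\sum_(f <- s) f w ^+ r)%:E <= (C *+ size s)%:E)%E.
  elim=> [_|f s IH fs].
    split; first by under eq_fun do rewrite big_nil; exact: measurable_cst.
    by under eq_integral do rewrite big_nil; rewrite integral0.
  have [mfs IHs] : _ /\ _ := IH (fun g gs => fs g (or_intror gs)).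
  have [mf f0 fC] := fs f (or_introl erefl).
  split.
    under eq_fun do rewrite big_cons.
    by apply: measurable_funD => //; exact: measurable_funX.
  under eq_integral do rewrite big_cons EFinD.
  rewrite ge0_integralD//; last 4 first.
  - by move=> w _; rewrite lee_fin exprn_ge0.
  - by apply/measurable_EFinP; exact: measurable_funX.
  - move=> w _; rewrite lee_fin.
    elim: s fs {IH mfs IHs} => [|g s IHg] fs; first by rewrite big_nil.
    rewrite big_cons addr_ge0//.
      by have [_ g0 _] := fs g (or_intror (or_introl erefl)); rewrite exprn_ge0.
    apply: IHg => k [<-|ks]; apply: fs; first by left.
    by right; right.
  - exact/measurable_EFinP.
  by rewrite mulrS EFinD leeD.
have [msum sumC] := sum_le _ termsP.
apply: (@le_trans _ _ (\int[P]_w (L%:E * (\sum_(f <- terms n t) f w ^+ r)%:E))%E).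
  apply: ge0_le_integral => //.
  - by move=> w _; rewrite lee_fin exprn_ge0// envelope_ge0.
  - by apply/measurable_EFinP; exact: measurable_funX.
  - by apply/measurable_EFinP; exact: measurable_funM.
  - move=> w _; rewrite -EFinM lee_fin.
    have f0 x : x \in [seq f w | f <- terms n t] -> 0 <= x.
      by rewrite /terms /= !inE => /or4P[/eqP->|/eqP->|/eqP->|/or4P[]/eqP->] //;
        rewrite ?sqr_ge0 ?normr_ge0.
    have := expr_sum_le r0 f0; rewrite !big_map size_map => hs.
    have e0 := envelope_ge0 XX n m w t.
    have Ks : 0 <= K * \sum_(f <- terms n t) f w by exact: le_trans (envelope_le w n0 tT).
    apply: (@le_trans _ _ ((K * \sum_(f <- terms n t) f w) ^+ r)).
      by rewrite lerXn2r ?nnegrE// envelope_le.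
    by rewrite exprMn /L -mulrA ler_wpM2l// exprn_ge0.
rewrite ge0_integralZl//; last 2 first.
- exact/measurable_EFinP.
- move=> w _; rewrite lee_fin /terms !big_cons big_nil addr0.
  by rewrite !addr_ge0// exprn_ge0 ?sqr_ge0.
by rewrite [leRHS]EFinM; apply: lee_wpmul2l; rewrite ?lee_fin.
Qed.

End envelope_moments.

Section discrepancy_moments.
Context d (T : measurableType d) (R : realType) (P : probability T R).
Variables (X : nat -> {RV P >-> R}) (mu sigma : R).
Hypothesis sigma0 : 0 < sigma.
Hypothesis lawX : forall k A, measurable A -> P (X k @^-1` A) = normal_prob mu sigma A.
Hypothesis indX : mutually_independent P (fun k => (X k : T -> R)).
Notation XX := (fun k => (X k : T -> R)).
Variables (TT : R) (m : nat) (wt : R -> R).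
Hypotheses (TT0 : 0 < TT) (m0 : (0 < m)%N).
Hypotheses (mwt : measurable_fun setT wt) (wt0 : forall t, 0 <= wt t)
  (wt1 : forall t, wt t <= 1).
Notation leb := (@lebesgue_measure R).
Local Notation env := (envelope XX).

Let TT0' : 0 <= TT. Proof. exact: ltW. Qed.

(** Both transforms have norm at most [1], so [|Un| <= 2 * sqrt n]. This bound grows with [n] and
    serves integrability over the window at fixed [n], never the uniform estimates. *)
Let B (n : nat) : R := (m.+1%:R + m%:R) * (2 * Num.sqrt n%:R).

Let mXX k : measurable_fun setT (XX k).
Proof. by []. Qed.

Let env_le (n : nat) (w : T) (t : R) : (0 < n)%N -> env n m w t <= B n.
Proof.
move=> n0; have U s : Normc.normc (Un XX n w s) <= 2 * Num.sqrt n%:R.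
  rewrite /Un Normc.normcM normc_real ger0_norm ?sqrtr_ge0// mulrC ler_wpM2r ?sqrtr_ge0//.
  apply: (le_trans (normc_triangle _ _)); rewrite normc_opp normc_real.
  rewrite (gtr0_norm (psi0_gt0 _)).
  by have := normc_ecf_std_le1 XX w n0 s; have := psi0_le1 s; lra.
by rewrite /B mulrDl; apply: lerD; rewrite ler_wpM2l.
Qed.

(** Order [2] dominates [n * Delta], order [3] dominates the error of the expansion, and order
    [2 * q] appears when the [q]-th power of the former is taken. *)
Let VX (r n : nat) (w : T) : R := time_integral TT (fun w t => env n m w t ^+ r) w.

Let menv (r n : nat) : measurable_fun setT (fun p : T * R => env n m p.1 p.2 ^+ r).
Proof.
apply: measurable_funX.
by apply: (@measurable_envelope _ _ (T * R)%type T R XX n m fst snd).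
Qed.

Let env0 (r n : nat) (w : T) (t : R) : 0 <= env n m w t ^+ r.
Proof. by rewrite exprn_ge0// envelope_ge0. Qed.

Let envB (r n : nat) (w : T) (t : R) : (0 < n)%N -> env n m w t ^+ r <= B n ^+ r.
Proof.
move=> n0; rewrite lerXn2r ?nnegrE ?envelope_ge0 ?env_le//.
by rewrite (le_trans _ (env_le w 0 n0))// envelope_ge0.
Qed.

Let iV (r n : nat) (w : T) : (0 < n)%N ->
  leb.-integrable `[- TT, TT] (EFin \o (fun t => env n m w t ^+ r)).
Proof.
move=> n0.
exact: (integrable_window TT0' (menv r n) (env0 r n) (fun w t => envB r w t n0)).
Qed.

Let fD (n : nat) (w : T) (t : R) : R := wt t * sqmod (Dm XX n m w t).
Let fH (n : nat) (w : T) (t : R) : R := wt t * psi0 t ^+ 2 * sqmod (Hm XX n m w t).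

Let fD0 (n : nat) (w : T) (t : R) : 0 <= fD n w t.
Proof. by rewrite mulr_ge0// sqr_ge0. Qed.

Let fH0 (n : nat) (w : T) (t : R) : 0 <= fH n w t.
Proof.
apply: mulr_ge0; last exact: sqr_ge0.
by apply: mulr_ge0 => //; exact: sqr_ge0.
Qed.

Let nfD_le (n : nat) (w : T) (t : R) : (0 < n)%N -> n%:R * fD n w t <= env n m w t ^+ 2.
Proof.
move=> n0; rewrite /fD mulrCA; apply: le_trans (sqmod_Dm_le XX w n0 m0 t).
by rewrite ler_piMl// mulr_ge0// sqr_ge0.
Qed.

Let fDB (n : nat) (w : T) (t : R) : (0 < n)%N -> fD n w t <= B n ^+ 2.
Proof.
move=> n0; apply: le_trans (envB 2 w t n0); apply: le_trans (nfD_le w t n0).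
by rewrite ler_peMl// ler1n.
Qed.

Let fHB (n : nat) (w : T) (t : R) : (0 < n)%N -> fH n w t <= B n ^+ 2.
Proof.
move=> n0; apply: le_trans (envB 2 w t n0).
rewrite /fH -mulrA; apply: le_trans (sqmod_Hm_le XX w n0 m0 t).
by rewrite ler_piMl// mulr_ge0// sqr_ge0.
Qed.

Let mfD (n : nat) : measurable_fun setT (fun p : T * R => fD n p.1 p.2).
Proof.
apply: measurable_funM; first exact: (measurableT_comp mwt measurable_snd).
by apply: (@measurable_sqmod_Dm _ _ (T * R)%type T R XX n m fst snd).
Qed.

Let mfH (n : nat) : measurable_fun setT (fun p : T * R => fH n p.1 p.2).
Proof.
apply: measurable_funM.
  apply: measurable_funM; first exact: (measurableT_comp mwt measurable_snd).
  by apply: measurable_funX; apply: measurable_psi0_comp; exact: measurable_snd.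
by apply: (@measurable_sqmod_Hm _ _ (T * R)%type T R XX n m fst snd).
Qed.

Let iD (n : nat) (w : T) : (0 < n)%N -> leb.-integrable `[- TT, TT] (EFin \o fD n w).
Proof.
move=> n0.
exact: (integrable_window TT0' (mfD n) (fD0 n) (fun w t => fDB w t n0)).
Qed.

Let iH (n : nat) (w : T) : (0 < n)%N -> leb.-integrable `[- TT, TT] (EFin \o fH n w).
Proof.
move=> n0.
exact: (integrable_window TT0' (mfH n) (fH0 n) (fun w t => fHB w t n0)).
Qed.

Let mD : measurable (`[- TT, TT]%classic : set (measurableTypeR R)).
Proof. exact: measurable_itv. Qed.

Let Dl (n : nat) (w : T) : R := Delta XX wt TT n m w.
Let Hl (n : nat) (w : T) : R := Rintegral leb `[- TT, TT] (fH n w).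

Let mDl (n : nat) : (0 < n)%N -> measurable_fun setT (Dl n).
Proof. by move=> n0; exact: (measurable_time_integral TT (mfD n) (fD0 n)). Qed.

Let mHl (n : nat) : (0 < n)%N -> measurable_fun setT (Hl n).
Proof. by move=> n0; exact: (measurable_time_integral TT (mfH n) (fH0 n)). Qed.

Lemma Delta_ge0 (n : nat) (w : T) : 0 <= n%:R * Dl n w.
Proof. by rewrite mulr_ge0//; apply: Rintegral_ge0 => t _; exact: fD0. Qed.

Lemma measurable_nDelta (n : nat) : (0 < n)%N -> measurable_fun setT (fun w => n%:R * Dl n w).
Proof. by move=> n0; apply: measurable_funM => //; exact: mDl. Qed.

Let inD (n : nat) (w : T) : (0 < n)%N ->
  leb.-integrable `[- TT, TT] (EFin \o (fun t => n%:R * fD n w t)).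
Proof. by move=> n0; exact: (integrableZl mD n%:R (iD w n0)). Qed.

Let nDlE (n : nat) (w : T) : (0 < n)%N ->
  n%:R * Dl n w = Rintegral leb `[- TT, TT] (fun t => n%:R * fD n w t).
Proof. by move=> n0; rewrite RintegralZl//; exact: iD. Qed.

Let nDl_le (n : nat) (w : T) : (0 < n)%N -> n%:R * Dl n w <= VX 2 n w.
Proof.
move=> n0; rewrite nDlE//; apply: le_Rintegral => //; [exact: inD|exact: iV|].
by move=> t _; exact: nfD_le.
Qed.

Let gap_le (n : nat) (w : T) : (0 < n)%N ->
  `|n%:R * (Dl n w - n%:R^-1 * Hl n w)| <= 2 / Num.sqrt n%:R * VX 3 n w.
Proof.
move=> n0; have nR : 0 < n%:R :> R by rewrite ltr0n.
have sn0 : 0 < Num.sqrt n%:R :> R by rewrite sqrtr_gt0.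
rewrite mulrBr mulrA divff ?gt_eqF// mul1r nDlE// /Hl -RintegralB//; [|exact: inD|exact: iH].
have iDH : leb.-integrable `[- TT, TT] (EFin \o (fun t => n%:R * fD n w t - fH n w t)).
  exact: (integrableB mD (inD w n0) (iH w n0)).
apply: (le_trans (le_normr_Rintegral mD iDH)).
rewrite /VX /time_integral -RintegralZl//; last exact: iV.
apply: le_Rintegral => //.
- exact: (integrable_abse iDH).
- exact: (integrableZl mD (2 / Num.sqrt n%:R) (iV 3 w n0)).
move=> t _; rewrite /fD /fH mulrCA -[X in _ - X]mulrA -mulrBr normrM ger0_norm//.
rewrite [leRHS]mulrAC; apply: le_trans (sqmod_Dm_Hm_gap XX w n0 m0 t).
by rewrite ler_piMl.
Qed.

(** Jensen's inequality for the uniform law on the window. The constant is the length to the power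
    [q - 1], written as a quotient so that no truncated subtraction appears. *)
Let jensen (q n : nat) (w : T) : (0 < n)%N ->
  VX 2 n w ^+ q <= (2 * TT) ^+ q / (2 * TT) * VX (2 * q) n w.
Proof.
move=> n0; have TT2 : 0 < 2 * TT by rewrite mulr_gt0.
pose y := VX 2 n w / (2 * TT).
have V0 : 0 <= VX 2 n w by apply: Rintegral_ge0 => t _; exact: env0.
have y0 : 0 <= y by rewrite divr_ge0// ltW.
have -> : VX 2 n w = 2 * TT * y by rewrite /y mulrC divfK// gt_eqF.
rewrite exprMn -mulrA ler_wpM2l ?exprn_ge0 ?(ltW TT2)//.
rewrite mulrC ler_pdivlMr//.
(* [c0 + c1 * x] is the tangent of [x ^ q] at the window average [y] of the squared envelope, so its
   integral along the squared envelope is exactly [2 * TT * y ^ q]. *)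
pose c1 := q%:R * y ^+ q.-1; pose c0 := y ^+ q - c1 * y.
have icst : leb.-integrable `[- TT, TT] (EFin \o (fun=> c0)).
  apply: measurable_bounded_integrable => //.
    by rewrite /= (lebesgue_measure_window TT0') ltry.
  exact: bounded_cst.
have i1 : leb.-integrable `[- TT, TT] (EFin \o (fun t => c1 * env n m w t ^+ 2)).
  exact: (integrableZl mD c1 (iV 2 w n0)).
have : Rintegral leb `[- TT, TT] (fun t => c0 + c1 * env n m w t ^+ 2) <= VX (2 * q) n w.
  apply: le_Rintegral => //; [exact: (integrableD mD icst i1)|exact: iV|].
  move=> t _; rewrite exprM; apply: le_trans (expr_tangent_le q (env0 2 n w t) y0).
  by rewrite -/c1 /c0; lra.
rewrite RintegralD// RintegralZl//; last exact: iV.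
have -> : (\int[leb]_(t in `[- TT, TT]) c0 = c0 * (2 * TT))%R.
  rewrite Rintegral_cst//; congr (_ * _); rewrite -[RHS]/(fine (2 * TT)%:E).
  by congr fine; exact: lebesgue_measure_window.
rewrite -/(time_integral TT (fun w t => env n m w t ^+ 2) w) -/(VX 2 n w).
have -> : VX 2 n w = 2 * TT * y by rewrite /y mulrC divfK// gt_eqF.
apply: le_trans; rewrite /c0 le_eqVlt; apply/orP; left; apply/eqP; ring.
Qed.

Let mVX (r n : nat) : measurable_fun setT (VX r n).
Proof. exact: (measurable_time_integral TT (menv r n) (env0 r n)). Qed.

Let VX_moment (r : nat) : (0 < r)%N -> exists2 C : R, 0 <= C &
  forall n : nat, (0 < n)%N -> (\int[P]_w (VX r n w)%:E <= C%:E)%E.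
Proof.
move=> r0; have [C C0 H] := envelope_moment sigma0 lawX indX TT0 m0 r0.
exists (C * (2 * TT)); first by rewrite !mulr_ge0.
move=> n n0.
apply: (integral_time_integral_le TT0' (menv r n) (env0 r n) (fun w t => envB r w t n0)).
by move=> t tT; exact: H.
Qed.

Let VX0 (r n : nat) (w : T) : 0 <= VX r n w.
Proof. by apply: Rintegral_ge0 => t _; exact: env0. Qed.

Lemma nDelta_moment (q : nat) : (0 < q)%N -> exists2 C : R, 0 <= C &
  forall n : nat, (0 < n)%N -> (\int[P]_w ((n%:R * Dl n w) ^+ q)%:E <= C%:E)%E.
Proof.
move=> q0; have q20 : (0 < 2 * q)%N by rewrite muln_gt0.
have [C C0 H] := VX_moment q20.
pose c : R := (2 * TT) ^+ q / (2 * TT).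
have c0 : 0 <= c by rewrite divr_ge0 ?exprn_ge0 ?mulr_ge0.
exists (c * C); first exact: mulr_ge0.
move=> n n0; apply: (@le_trans _ _ (\int[P]_w (c%:E * (VX (2 * q) n w)%:E))%E).
  apply: ge0_le_integral => //.
  - by move=> w _; rewrite lee_fin exprn_ge0// Delta_ge0.
  - by apply/measurable_EFinP; apply: measurable_funX; exact: measurable_nDelta.
  - by apply/measurable_EFinP; apply: measurable_funM => //; exact: mVX.
  - move=> w _; rewrite -EFinM lee_fin; apply: le_trans (jensen q w n0).
    by rewrite lerXn2r ?nnegrE ?Delta_ge0 ?VX0 ?nDl_le.
rewrite ge0_integralZl//; last 2 first.
- by apply/measurable_EFinP; exact: mVX.
- by move=> w _; rewrite lee_fin VX0.
by rewrite [leRHS]EFinM; apply: lee_wpmul2l; [rewrite lee_fin|exact: H].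
Qed.

Lemma nDelta_expansion_prob (eps : R) : 0 < eps -> exists c : R,
  forall n : nat, (0 < n)%N ->
  (P [set w | (eps < `|n%:R * (Dl n w - n%:R^-1 * Hl n w)|)%R] <=
   (c / Num.sqrt n%:R)%:E)%E.
Proof.
move=> eps0; have [C C0 H] := VX_moment (isT : (0 < 3)%N).
exists (2 * C / eps) => n n0.
have sn0 : 0 < Num.sqrt n%:R :> R by rewrite sqrtr_gt0 ltr0n.
have -> : 2 * C / eps / Num.sqrt n%:R = 2 / Num.sqrt n%:R * C / eps.
  by field; rewrite !gt_eqF.
have c0 : 0 <= 2 / Num.sqrt n%:R :> R by rewrite divr_ge0// ltW.
have mZ : measurable_fun setT (fun w => `|n%:R * (Dl n w - n%:R^-1 * Hl n w)|).
  apply: measurableT_comp => //; apply: measurable_funM => //.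
  apply: measurable_funB; first exact: mDl.
  by apply: measurable_funM => //; exact: mHl.
apply: markov_bound => //.
apply: (@le_trans _ _ (\int[P]_w ((2 / Num.sqrt n%:R)%:E * (VX 3 n w)%:E))%E).
  apply: ge0_le_integral => //.
  - exact/measurable_EFinP.
  - by apply/measurable_EFinP; apply: measurable_funM => //; exact: mVX.
  - by move=> w _; rewrite -EFinM lee_fin gap_le.
rewrite ge0_integralZl//; last 2 first.
- by apply/measurable_EFinP; exact: mVX.
- by move=> w _; rewrite lee_fin VX0.
by rewrite [leRHS]EFinM; apply: lee_wpmul2l; [rewrite lee_fin|exact: H].
Qed.

End discrepancy_moments.

(** * Tightness, moments of real order and uniform integrability from integer moments *)

Lemma powR_le_1Dexpr (R : realType) (x p : R) (q : nat) :
  0 <= x -> 0 <= p -> p <= q%:R -> x `^ p <= 1 + x ^+ q.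
Proof.
(* Raising the exponent from [p] to [q] increases the power only when [x > 1]; the summand [1]
   covers the rest. *)
move=> x0 p0 pq; have [x1|x1] := leP x 1.
  apply: (@le_trans _ _ (1 `^ p)); first by apply: ge0_ler_powR; rewrite ?nnegrE.
  by rewrite powR1 lerDl exprn_ge0.
apply: (@le_trans _ _ (x `^ q%:R)); first by apply: ler_powR => //; exact: ltW.
by rewrite powR_mulrn// lerDr.
Qed.

Lemma cvg_div_sqrt_nat (R : realType) (c : R) :
  c / Num.sqrt n%:R @[n --> \oo] --> (0 : R).
Proof.
apply/cvgr0Pnorm_lt => e e0; near=> n.
have n0 : (0 < n)%N by near: n; exact: nbhs_infty_gt.
have sn0 : 0 < Num.sqrt n%:R :> R by rewrite sqrtr_gt0 ltr0n.
rewrite normrM normfV (gtr0_norm sn0) ltr_pdivrMr// mulrC -ltr_pdivrMr//.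
have ce0 : 0 <= `|c| / e by rewrite divr_ge0// ltW.
rewrite -[ltLHS]ger0_norm// -sqrtr_sqr ltr_sqrt ?ltr0n//.
by near: n; exact: nbhs_infty_gtr.
Unshelve. all: end_near. Qed.

Section moments_consequences.
Context d (T : measurableType d) (R : realType) (P : probability T R).
Variable Y : nat -> T -> R.
Hypothesis mY : forall n, (0 < n)%N -> measurable_fun setT (Y n).
Hypothesis Y0 : forall n w, 0 <= Y n w.
Hypothesis momY : forall q : nat, (0 < q)%N -> exists2 C : R, 0 <= C &
  forall n : nat, (0 < n)%N -> (\int[P]_w (Y n w ^+ q)%:E <= C%:E)%E.

Lemma tightness_of_moments (eps : R) : 0 < eps -> exists K : R, exists N : nat,
  forall n : nat, (N <= n)%N -> (P [set w | (K < Y n w)%R] <= eps%:E)%E.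
Proof.
move=> eps0; have [C C0 H] := momY (isT : (0 < 1)%N).
(* The added [1] keeps the threshold positive when [C = 0], as Markov's inequality requires. *)
exists (C / eps + 1), 1%N => n n0.
have K0 : 0 < C / eps + 1 by rewrite ltr_wpDl// divr_ge0// ltW.
apply: (@le_trans _ _ (C / (C / eps + 1))%:E).
  apply: markov_bound => //; first exact: mY.
  by apply: le_trans (H n n0).
rewrite lee_fin ler_pdivrMr// mulrDr mulr1 mulrC divfK ?gt_eqF// lerDl ltW//.
Qed.

Let integral_1D (q : nat) : (0 < q)%N -> exists2 C : R, 0 <= C &
  forall n : nat, (0 < n)%N -> (\int[P]_w (1 + Y n w ^+ q)%:E <= C%:E)%E.
Proof.
move=> q0; have [C C0 H] := momY q0.
exists (1 + C); first by rewrite addr_ge0.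
move=> n n0; under eq_integral do rewrite EFinD.
rewrite ge0_integralD//; last 2 first.
- by move=> w _; rewrite lee_fin exprn_ge0.
- by apply/measurable_EFinP; apply: measurable_funX; exact: mY.
rewrite integral_cst// mul1e EFinD; apply: leeD; last exact: H.
by rewrite [leLHS]probability_setT.
Qed.

Lemma real_moments_bounded (p : R) : 1 <= p -> exists C : R, forall n : nat,
  (0 < n)%N -> ('E_P[fun w => (Y n w `^ p)%R] <= C%:E)%E.
Proof.
move=> p1; have p0 : 0 <= p by exact: le_trans p1.
pose q := Num.bound p; have pq := archi_boundP p0.
have q0 : (0 < q)%N by rewrite -(ltr0n R) (le_lt_trans p0).
have [C C0 H] := integral_1D q0; exists C => n n0.
rewrite unlock; apply: le_trans (H n n0); apply: ge0_le_integral => //.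
- by move=> w _; rewrite lee_fin powR_ge0.
- apply/measurable_EFinP; apply: (measurableT_comp (@measurable_powR R p)).
  exact: mY.
- apply/measurable_EFinP; apply: measurable_funD => //; apply: measurable_funX.
  exact: mY.
- by move=> w _; rewrite lee_fin powR_le_1Dexpr// ltW.
Qed.

(** De la Vallée-Poussin's criterion in its simplest form: where [Y ^ p] exceeds [K], it is at most
    [Y ^ (2 * p) / K], hence at most [(1 + Y ^ q) / K] for an integer [q >= 2 * p], and this has
    expectation at most [C / K]. *)
Lemma unif_integrable_powR (p : R) : 1 <= p ->
  unif_integrable P (fun n w => Y n w `^ p).
Proof.
move=> p1 eps eps0; have p0 : 0 <= p by exact: le_trans p1.
pose q := Num.bound (p + p); have pq := archi_boundP (addr_ge0 p0 p0).
have q0 : (0 < q)%N by rewrite -(ltr0n R) (le_lt_trans _ pq)// addr_ge0.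
have [C C0 H] := integral_1D q0.
pose K := C / eps + 1.
have K0 : 0 < K by rewrite ltr_wpDl// divr_ge0// ltW.
exists K => n n0.
have mYp : measurable_fun setT (fun w => Y n w `^ p).
  by apply: (measurableT_comp (@measurable_powR R p)); exact: mY.
pose A := [set w | K < `|Y n w `^ p|].
have mA : measurable A.
  have -> : A = (fun w => `|Y n w `^ p|) @^-1` [set` `]K, +oo[].
    by apply/seteqP; split=> w /=; rewrite in_itv/= andbT.
  have mn : measurable_fun setT (fun w => `|Y n w `^ p|) by exact: measurableT_comp.
  by rewrite -[X in measurable X]setTI; apply: mn => //; exact: measurable_itv.
rewrite unlock (_ : (fun w => _) = (fun w => (`|Y n w `^ p| * \1_A w)%:E)); last first.
  apply/funext => w; congr EFin; rewrite indicE.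
  have -> : (w \in A) = (K < `|Y n w `^ p|)
    by apply/idP/idP => [hw|hw]; [exact: (set_mem hw)|exact: mem_set].
  by case: ifP; rewrite ?mulr1 ?mulr0.
apply: (@le_trans _ _ (\int[P]_w ((K^-1)%:E * (1 + Y n w ^+ q)%:E))%E).
  apply: ge0_le_integral => //.
  - apply/measurable_EFinP; apply: measurable_funM; last exact: measurable_indic.
    exact: measurableT_comp.
  - apply/measurable_EFinP; apply: measurable_funM => //; apply: measurable_funD => //.
    by apply: measurable_funX; exact: mY.
  - move=> w _; rewrite -EFinM lee_fin indicE.
    have x1 : 0 <= 1 + Y n w ^+ q by rewrite addr_ge0// exprn_ge0.
    case: (boolP (w \in A)) => [/set_mem h|_]; last first.
      by rewrite mulr0 mulr_ge0// invr_ge0 ltW.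
    rewrite mulr1 ler_pdivlMl//.
    apply: (@le_trans _ _ (Y n w `^ (p + p))); last first.
      by apply: powR_le_1Dexpr => //; [exact: addr_ge0|exact: ltW].
    have -> : Y n w `^ (p + p) = Y n w `^ p * Y n w `^ p.
      by apply: powRD; apply/implyP => /eqP; lra.
    have hK : K < `|Y n w `^ p| by exact: h.
    by move: hK; rewrite ger0_norm ?powR_ge0// => hK; rewrite ler_wpM2r ?powR_ge0// ltW.
rewrite ge0_integralZl//; last 3 first.
- apply/measurable_EFinP; apply: measurable_funD => //.
  by apply: measurable_funX; exact: mY.
- by move=> w _; rewrite lee_fin addr_ge0// exprn_ge0.
- by rewrite lee_fin invr_ge0 ltW.
apply: (@le_trans _ _ ((K^-1)%:E * C%:E)%E).
  by apply: lee_wpmul2l; [rewrite lee_fin invr_ge0 ltW|exact: H].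
rewrite -EFinM lee_fin ler_pdivrMl// /K mulrDl mul1r divfK ?gt_eqF//.
by rewrite lerDl ltW.
Qed.

End moments_consequences.

Unset Implicit Arguments.
Set Strict Implicit.
Set Printing Implicit Defensive.

Theorem theorem1 (d : measure_display) (Omega : measurableType d) (R : realType)
  (P : probability Omega R) (X : nat -> {RV P >-> R})
  (mu sigma : R) (TT : R) (M : nat) (beta : R) (m : nat) :
  (0 < sigma)%R ->
  (forall k A, measurable A -> P (X k @^-1` A) = normal_prob mu sigma A) ->
  mutually_independent P (fun k => (X k : Omega -> R)) ->
  (0 < TT)%R -> (0 < beta)%R -> (1 <= m <= M)%N ->
  let w := fun t : R => expR (- beta * t ^+ 2) in
  let Dl := fun n => Delta (fun k => (X k : Omega -> R)) w TT n m in
  let Hn := fun n => Hm (fun k => (X k : Omega -> R)) n m in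
  (* Delta = (1/n) int w psi0^2 |H|^2 + o_P(1/n) *)
  (forall eps : R, (0 < eps)%R ->
     (fun n : nat => P [set om | eps < `| n%:R *
        (Dl n om - n%:R^-1 * Rintegral lebesgue_measure `[- TT, TT]
            (fun t => w t * psi0 t ^+ 2 * sqmod (Hn n om t))) | ])
     @ \oo --> 0%E) /\
  (* Delta = O_P(1/n) *)
  (forall eps : R, (0 < eps)%R -> exists K : R, exists N : nat,
     forall n : nat, (N <= n)%N -> (P [set om | (K < n%:R * Dl n om)%R] <= eps%:E)%E) /\
  (* bounded moments of every order p >= 1 *)
  (forall p : R, (1 <= p)%R -> exists C : R, forall n : nat, (0 < n)%N ->
     ('E_P[fun om => ((n%:R * Dl n om) `^ p)%R] <= C%:E)%E) /\
  (* uniform integrability *)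
  (forall p : R, (1 <= p)%R ->
     unif_integrable P (fun n om => (n%:R * Dl n om) `^ p)).
Proof.
move=> sigma0 lawX indX TT0 beta0 /andP[m0 _] w Dl Hn.
have mw : measurable_fun setT w.
  by apply: (measurableT_comp (@measurable_expR R)); apply: measurable_funM.
have w0 t : 0 <= w t by exact: expR_ge0.
have w1 t : w t <= 1.
  by rewrite -[leRHS]expR0 ler_expR mulNr oppr_le0 mulr_ge0 ?sqr_ge0 ?ltW.
have mom := nDelta_moment sigma0 lawX indX TT0 m0 mw w0 w1.
have mY n : (0 < n)%N -> measurable_fun setT (fun om => n%:R * Dl n om).
  exact: (measurable_nDelta X TT m mw w0).
have Y0 n om : 0 <= n%:R * Dl n om.
  exact: (Delta_ge0 X TT m w0).
split; last split; last split.
- move=> eps eps0.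
  have [c Hc] := nDelta_expansion_prob sigma0 lawX indX TT0 m0 mw w0 w1 eps0.
  apply: (@squeeze_cvge _ _ _ _ (cst 0%E) _ (fun n => (c / Num.sqrt n%:R)%:E)).
  + near=> n; rewrite measure_ge0/=; apply: Hc.
    by near: n; exact: nbhs_infty_gt.
  + exact: cvg_cst.
  + by apply: cvg_EFin; [exact: nearW|exact: cvg_div_sqrt_nat].
- by move=> eps eps0; exact: (tightness_of_moments mY Y0 mom eps0).
- by move=> p p1; exact: (real_moments_bounded mY Y0 mom p1).
- by move=> p p1; exact: (unif_integrable_powR mY Y0 mom p1).
Unshelve. all: by end_near. Qed.
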